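(* Let $\varepsilon>0$ be a constant and suppose that $p=p(n)$ and $N=N(n)$ satisfy $p \gg (\log n)^2/n$ (that is, $pn/(\log n)^2\to\infty$) and $N \le (1-\varepsilon)np/2$. If $T_1,\dotsc,T_N$ are trees, each of which has at most $(1-\varepsilon)n$ vertices and maximum degree at most $(\varepsilon/8)^8\, np/\log n$, then asymptotically almost surely $T_1,\dotsc,T_N$ pack into $G(n,p)$.
   Context: $G(n,p)$ is the binomial random graph on $n$ vertices in which each possible edge is present independently with probability $p$. A collection of graphs $G_1,\dotsc,G_t$ packs into a graph $G$ if there exist pairwise edge-disjoint subgraphs $H_1,\dotsc,H_t$ of $G$ with $H_i$ isomorphic to $G_i$ for every $i$. ''Asymptotically almost surely'' means with probability tending to $1$ as $n\to\infty$. $\log$ denotes the natural logarithm. *)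

(* Defs.v *)
From HB Require Import structures.
From mathcomp Require Import all_boot all_order all_algebra.
From mathcomp Require Import all_classical all_reals all_analysis.
Set Implicit Arguments.
Unset Strict Implicit.
Unset Printing Implicit Defensive.
Import Order.TTheory GRing.Theory Num.Theory.
Import numFieldNormedType.Exports.
Local Open Scope ring_scope.

Record graph := Graph {
  vertex :> finType;
  adj : rel vertex;
  adj_sym : symmetric adj;
  adj_irr : irreflexive adj }.

Definition isomorphic (G H : graph) : Prop :=
  exists2 f : G -> H, bijective f & forall x y, adj (f x) (f y) = adj x y.

Definition degree (G : graph) (x : G) : nat := #|[set y | adj x y]|.

Definition max_degree (G : graph) : nat := (\max_(x : G) degree x)%N.

Definition connected_graph (G : graph) : Prop :=
  (0 < #|G|)%N /\ forall x y : G, connect (@adj G) x y.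

(* [ucycle] also accepts an edge traversed back and forth, as a closed walk of
   length 2; the cycles of a simple graph are those of length at least 3. *)
Definition acyclic_graph (G : graph) : Prop :=
  forall c : seq G, ucycle (@adj G) c -> (size c < 3)%N.

Definition is_tree (G : graph) : Prop := connected_graph G /\ acyclic_graph G.

(* Not necessarily induced, nor spanning. *)
Record subgraph (G : graph) := Subgraph {
  sub_vertex : {set G};
  sub_adj : rel G;
  sub_adj_sym : symmetric sub_adj;
  sub_adj_vertex : forall x y, sub_adj x y -> x \in sub_vertex;
  sub_adj_adj : forall x y, sub_adj x y -> adj x y }.

Section GraphOfSubgraph.
Variables (G : graph) (H : subgraph G).

Let sub_rel : rel {x : G | x \in sub_vertex H} :=
  fun x y => sub_adj H (val x) (val y).

Fact sub_rel_sym : symmetric sub_rel.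
Proof. by move=> x y; apply: sub_adj_sym. Qed.

Fact sub_rel_irr : irreflexive sub_rel.
Proof.
by move=> x; apply/negP => /(@sub_adj_adj _ H); rewrite adj_irr.
Qed.

Definition graph_of_subgraph : graph := Graph sub_rel_sym sub_rel_irr.
End GraphOfSubgraph.

Definition edge_disjoint (G : graph) (H K : subgraph G) : Prop :=
  forall x y, ~~ (sub_adj H x y && sub_adj K x y).

Definition packs (t : nat) (F : 'I_t -> graph) (G : graph) : Prop :=
  exists H : 'I_t -> subgraph G,
    (forall i, isomorphic (graph_of_subgraph (H i)) (F i)) /\
    (forall i j, i != j -> edge_disjoint (H i) (H j)).

Definition possible_edges (n : nat) : {set {set 'I_n}} :=
  [set e : {set 'I_n} | #|e| == 2]%N.

Section GraphOfEdges.
Variables (n : nat) (E : {set {set 'I_n}}).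

Let edge_rel : rel 'I_n := fun x y => (x != y) && ([set x; y]%SET \in E).

Fact edge_rel_sym : symmetric edge_rel.
Proof. by move=> x y; rewrite /edge_rel eq_sym finset.setUC. Qed.

Fact edge_rel_irr : irreflexive edge_rel.
Proof. by move=> x; rewrite /edge_rel eqxx. Qed.

Definition graph_of_edges : graph := Graph edge_rel_sym edge_rel_irr.
End GraphOfEdges.

(* The probability that [G(n,p)] has edge set exactly [E], for a set [E] of
   possible edges. *)
Definition gnp_weight (R : realType) (n : nat) (p : R) (E : {set {set 'I_n}})
    : R :=
  \prod_(e in possible_edges n) (if e \in E then p else 1 - p).

(* The probability that [G(n,p)] satisfies [A]. *)
Definition gnp_prob (R : realType) (n : nat) (p : R) (A : graph -> Prop) : R :=
  \sum_(E in powerset (possible_edges n) | `[< A (graph_of_edges E) >])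
    gnp_weight p E.

(* Main.v *)
Require Import Defs.
From HB Require Import structures.
From mathcomp Require Import all_boot all_order all_algebra.
From mathcomp Require Import all_classical all_reals all_analysis.
From mathcomp Require Import fintype finset ring lra zify.
Set Implicit Arguments.
Unset Strict Implicit.
Unset Printing Implicit Defensive.
Import Order.TTheory GRing.Theory Num.Theory.
Import numFieldNormedType.Exports.
Local Open Scope set_scope.
Local Open Scope ring_scope.

(** Online sprinkling. The trees are embedded one after another, each vertex by
    vertex in an order where parents precede children. To place a child of the
    vertex sitting at [v], draw a uniformly random admissible [u] and let the
    pair [uv] succeed with a tiny probability [q], at the expense of [q] units of
    the budget [r uv] of probability that [uv] started with; repeat until a
    success, then put the child at [u]. Whatever the budgets, [u] is uniform
    among the admissible vertices, so the embedding is a random process on its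
    own; a vertex is admissible if it is unused by the tree, is not joined to [v]
    by a used edge, and has small degree in the graph of used edges. The process
    can only fail by exhausting the budget of some pair, and this is controlled
    by the exponential potential [sum_e exp (- lam r_e) G_e], where [G_e] is the
    conditional expectation of the exponential of [lam] times the amount that the
    current tree will still spend on [e]. Since edges used by a
    few trees hardly bias the embedding, a tree with [m] vertices spends about
    [2 m / n^2] on each pair, in portions of size [O (Delta / n)], and the total
    stays below [p] with exponentially small failure probability, well below
    [n^-2]. For the used degrees to be small compared with [n] one needs [p] to
    be a small constant; this is achieved by colouring the edges of [G(n,p)]
    with [K] colours and the trees with [K] colours, where [K] is constant. *)

(** * Product measures *)

Section ProductMeasure.
Variables (R : realType) (D : finType).
Implicit Types (r : D -> R) (E : {set D}) (A B : {set D} -> Prop).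

Definition wt r E : R := \prod_e (if e \in E then r e else 1 - r e).

Definition Pr r A : R := \sum_E wt r E * `[<A E>]%:R.

Definition up_closed A := forall E E', E \subset E' -> A E -> A E'.

Definition prob_vector r := forall e, 0 <= r e <= 1.

(** Budget left at [e] after a failed trial. For $q<1$, exact conditioning would leave
    $(r_e-q)/(1-q)$; the smaller value $r_e-q$ suffices for up-closed events and makes the cost of a
    trial additive. *)
Definition lower r (e : D) (q : R) : D -> R :=
  fun x => if x == e then r e - q else r x.

Lemma sum_set_split (e : D) (F : {set D} -> R) :
  \sum_E F E = \sum_(E : {set D} | e \notin E) (F (e |: E) + F E).
Proof.
rewrite (bigID (fun E : {set D} => e \in E)) /= big_split /=; congr (_ + _).
rewrite (reindex_onto (fun E => e |: E) (fun E => E :\ e)) /=; last first.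
  by move=> E eE; rewrite setD1K.
apply: eq_bigl => E; rewrite setU11 /=.
apply/eqP/idP => [<-|eE]; first by rewrite setD11.
by rewrite setU1K.
Qed.

Lemma wt_ge0 r E : prob_vector r -> 0 <= wt r E.
Proof.
move=> r01; apply: prodr_ge0 => e _; have /andP[r0 r1] := r01 e.
by case: ifP => _ //; rewrite subr_ge0.
Qed.

Definition wt_off r (e : D) E : R :=
  \prod_(x | x != e) (if x \in E then r x else 1 - r x).

Lemma Pr_split r e A : Pr r A = \sum_(E : {set D} | e \notin E)
  wt_off r e E * (r e * `[<A (e |: E)>]%:R + (1 - r e) * `[<A E>]%:R).
Proof.
rewrite /Pr (sum_set_split e); apply: eq_bigr => E eE.
have -> : wt r (e |: E) = r e * wt_off r e E.
  rewrite /wt (bigD1 e) //= setU11; congr (_ * _).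
  by apply: eq_bigr => x xe; rewrite !inE (negPf xe).
have -> : wt r E = (1 - r e) * wt_off r e E.
  by rewrite /wt (bigD1 e) //= (negPf eE).
ring.
Qed.

Lemma wt_off_lower r e q E : wt_off (lower r e q) e E = wt_off r e E.
Proof. by apply: eq_bigr => x xe; rewrite /lower (negPf xe). Qed.

Lemma wt_off_ge0 r e E : prob_vector r -> 0 <= wt_off r e E.
Proof.
move=> r01; apply: prodr_ge0 => x _; have /andP[r0 r1] := r01 x.
by case: ifP => _ //; rewrite subr_ge0.
Qed.

(** For $q<1$, the presence of [e] is the union of a trial of probability $q$ and an independent one
    of probability $(r_e-q)/(1-q)\ge r_e-q$. After a success [e] is present and the other pairs are
    untouched, so evaluating [B] under the unchanged [r] only undercounts. Conditioning on all other
    pairs reduces the claim to four indicators. *)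
Lemma Pr_expose r e q A B : prob_vector r -> 0 <= q <= r e ->
  up_closed A -> up_closed B -> (forall E, B E -> e \in E -> A E) ->
  q * Pr r B + (1 - q) * Pr (lower r e q) A <= Pr r A.
Proof.
move=> r01 /andP[q0 qr] upA upB BA.
rewrite !(Pr_split _ e) !mulr_sumr -big_split /=; apply: ler_sum => E eE.
rewrite wt_off_lower mulrCA (mulrCA (1 - q)) -mulrDr.
apply: ler_wpM2l; first exact: wt_off_ge0.
rewrite /lower eqxx.
have /andP[r0 r1] := r01 e.
have B01 : `[<B E>] ==> `[<B (e |: E)>].
  by apply/implyP=> /asboolP BE; apply/asboolP; apply: upB BE; exact: subsetUr.
have A01 : `[<A E>] ==> `[<A (e |: E)>].
  by apply/implyP=> /asboolP BE; apply/asboolP; apply: upA BE; exact: subsetUr.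
have BA1 : `[<B (e |: E)>] ==> `[<A (e |: E)>].
  apply/implyP=> /asboolP BE; apply/asboolP; apply: BA BE _; exact: setU11.
case: `[<B E>] B01; case: `[<B (e |: E)>] BA1; case: `[<A E>] A01;
  case: `[<A (e |: E)>] => //= _ _ _; nra.
Qed.

Lemma le_Pr r A B : prob_vector r -> (forall E, A E -> B E) -> Pr r A <= Pr r B.
Proof.
move=> r01 AB; apply: ler_sum => E _; apply: ler_wpM2l; first exact: wt_ge0.
rewrite ler_nat; case: asboolP => // AE; case: asboolP => // nBE.
by case: nBE; exact: AB.
Qed.

Lemma Pr_ge0 r A : prob_vector r -> 0 <= Pr r A.
Proof. by move=> r01; apply: sumr_ge0 => E _; rewrite mulr_ge0 ?wt_ge0. Qed.

(** Image of a product measure under a coordinatewise map [k]; it serves to read the laws of several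
    random sets off one three-valued assignment. *)
Lemma sum_pushforward (S S' : finType) (k : S -> S') (w : D -> S -> R)
    (h : {ffun D -> S'} -> R) :
  \sum_(g : {ffun D -> S}) (\prod_e w e (g e)) * h [ffun e => k (g e)] =
  \sum_(g' : {ffun D -> S'}) (\prod_e \sum_(s | k s == g' e) w e s) * h g'.
Proof.
rewrite (partition_big (fun g : {ffun D -> S} => [ffun e => k (g e)]) predT) //=.
apply: eq_bigr => g' _.
rewrite bigA_distr_big_dep mulr_suml.
apply: eq_big => [g|g /eqP -> //].
apply/eqP/familyP => [<- e|gg']; first by rewrite unfold_in ffunE.
by apply/ffunP => e; rewrite ffunE; have := gg' e; rewrite unfold_in => /eqP.
Qed.

Definition bool_wt r (e : D) (b : bool) : R := if b then r e else 1 - r e.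

Lemma Pr_ffun r A : Pr r A =
  \sum_(g : {ffun D -> bool}) (\prod_e bool_wt r e (g e)) *
     `[<A [set e | g e]>]%:R.
Proof.
rewrite /Pr (reindex (fun g : {ffun D -> bool} => [set e | g e])) /=; last first.
  exists (fun E => [ffun e => e \in E]) => [g|E] _.
    by apply/ffunP => e; rewrite ffunE inE.
  by apply/setP => e; rewrite inE ffunE.
apply: eq_bigr => g _; congr (_ * _); apply: eq_bigr => e _.
by rewrite inE.
Qed.

Lemma sum_ffun_prob1 (S : finType) (w : D -> S -> R) :
  (forall e, \sum_s w e s = 1) -> \sum_(g : {ffun D -> S}) \prod_e w e (g e) = 1.
Proof.
by move=> w1; rewrite -bigA_distr_bigA big1 // => e _; rewrite w1.
Qed.

Lemma sum_option_bool (F : option bool -> R) :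
  \sum_s F s = F None + F (Some true) + F (Some false).
Proof.
rewrite (bigD1 None) //= (bigD1 (Some true)) //= (bigD1 (Some false)) //=.
by rewrite big1 ?addr0 ?addrA // => -[[]|].
Qed.

Lemma Pr_true r : Pr r (fun=> True) = 1.
Proof.
rewrite Pr_ffun -[RHS](sum_ffun_prob1 (w := bool_wt r)); last first.
  by move=> e; rewrite big_bool /= /bool_wt; ring.
by apply: eq_bigr => g _; case: asboolP => // _; rewrite mulr1.
Qed.

(* Three-valued product measure: each edge goes to the first class, to the
   second class, or to neither ([None]). *)
Lemma Pr_disjoint_union r1 r2 A B (C : {set D} -> Prop) :
  (forall e, 0 <= r1 e) -> (forall e, 0 <= r2 e) -> (forall e, r1 e + r2 e <= 1) ->
  (forall E1 E2, E1 :&: E2 = set0 -> A E1 -> B E2 -> C (E1 :|: E2)) ->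
  Pr r1 A + Pr r2 B - 1 <= Pr (fun e => r1 e + r2 e) C.
Proof.
move=> r10 r20 r121 ABC.
pose w (e : D) (s : option bool) : R :=
  if s is Some b then (if b then r1 e else r2 e) else 1 - (r1 e + r2 e).
have w1 e : \sum_s w e s = 1.
  rewrite sum_option_bool /w; ring.
have push (k : option bool -> bool) r X :
    (forall e b, \sum_(s | k s == b) w e s = bool_wt r e b) ->
    Pr r X = \sum_(g : {ffun D -> option bool}) (\prod_e w e (g e)) *
       `[<X [set e | k (g e)]>]%:R.
  move=> kr; rewrite Pr_ffun.
  under eq_bigr => g' _ do under eq_bigr => e _ do rewrite -kr.
  rewrite -(sum_pushforward k w (fun g' => `[<X [set e | g' e]>]%:R)).
  apply: eq_bigr => g _; congr (_ * `[<X _>]%:R).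
  by apply/setP => e; rewrite !inE ffunE.
rewrite (push (fun s => s == Some true) r1); last first.
  by move=> e b; rewrite big_mkcond sum_option_bool /= /w /bool_wt; case: b => /=; ring.
rewrite (push (fun s => s == Some false) r2); last first.
  by move=> e b; rewrite big_mkcond sum_option_bool /= /w /bool_wt; case: b => /=; ring.
rewrite (push isSome _ C); last first.
  by move=> e b; rewrite big_mkcond sum_option_bool /= /w /bool_wt; case: b => /=; ring.
(* A union bound, pointwise in the assignment [g]: $1_A+1_B-1\le 1_C$. *)
rewrite -[X in _ - X <= _](sum_ffun_prob1 w1) -big_split -sumrB /=.
apply: ler_sum => g _.
have W0 : 0 <= \prod_e w e (g e).
  apply: prodr_ge0 => e _; rewrite /w; case: (g e) => [[]|] //.
  by rewrite subr_ge0.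
rewrite -mulrDr -[X in _ - X <= _]mulr1 -mulrBr; apply: ler_wpM2l => //.
set E1 := [set e | g e == Some true]; set E2 := [set e | g e == Some false].
have -> : [set e | isSome (g e)] = E1 :|: E2.
  by apply/setP => e; rewrite !inE; case: (g e) => [[]|].
have dis : E1 :&: E2 = set0.
  by apply/setP => e; rewrite !inE; case: (g e) => [[]|].
case: (asboolP (C _)) => [_|nC]; first by case: `[<_>]; case: `[<_>] => /=; lra.
case: (asboolP (A _)) => [AE|_]; case: (asboolP (B _)) => [BE|_] /=; try lra.
by case: nC; exact: ABC.
Qed.

End ProductMeasure.

(** * Exposing pairs until one succeeds, and the exponential potential *)

Section Exposure.
Variables (R : realType) (D : finType) (S : {set D}) (C lam q : R).
Implicit Types (r : D -> R) (G : D -> R).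

(** An exponential-moment bound for the failure probability: the term of [e] is large when the
    remaining budget [r e] is small compared with the spending still ahead, which [G e] measures. *)
Definition potential r G : R := C * \sum_(e in S) expR (- (lam * r e)) * G e.

Lemma prob_vector_lower r e : prob_vector r -> 0 <= q <= r e ->
  prob_vector (lower r e q).
Proof.
move=> r01 /andP[q0 qr] x; rewrite /lower; case: ifP => _ //.
have /andP[_ r1] := r01 e.
by rewrite subr_ge0 qr (le_trans _ r1) // gerBl.
Qed.

Lemma expose_until_success (I : finType) (cand : {set I}) (ed : I -> D)
    (A : {set D} -> Prop) (B : I -> {set D} -> Prop) G (G' : I -> D -> R)
    (theta : R) :
  (0 < #|cand|)%N -> 0 < q <= 1 -> 0 <= lam -> 1 <= C * expR (- (lam * q)) ->
  (1 - q) * (expR (lam * q) - 1) <= theta * q ->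
  {in cand &, injective ed} -> (forall u, u \in cand -> ed u \in S) ->
  up_closed A -> (forall u, up_closed (B u)) ->
  (forall u E, u \in cand -> B u E -> ed u \in E -> A E) ->
  (forall u r, u \in cand -> prob_vector r ->
     1 - potential r (G' u) <= Pr r (B u)) ->
  (forall e, e \in S -> 1 <= G e) ->
  (forall e, e \in S -> \sum_(u in cand) G' u e <=
     #|cand|%:R * G e - (e \in ed @: cand)%:R * (theta * G e)) ->
  forall r, prob_vector r -> 1 - potential r G <= Pr r A.
Proof.
move=> cand0 /andP[q0 q1] lam0 Cq thetaq ed_inj edS upA upB BA IHB G1 avgG.
have C0 : 0 <= C.
  by rewrite -(pmulr_lge0 _ (expR_gt0 (- (lam * q)))) (le_trans _ Cq).
have term0 r e : e \in S -> 0 <= expR (- (lam * r e)) * G e.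
  by move=> eS; rewrite mulr_ge0 ?expR_ge0 // (le_trans _ (G1 e eS)).
(* Every failed trial removes [q] from the total budget, so the repetition ends by induction on a
   bound [k] for that total in units of [q]. *)
suff H k r : prob_vector r -> \sum_(e in S) r e <= k%:R * q ->
    1 - potential r G <= Pr r A.
  move=> r r01; apply: (H (Num.bound (\sum_(e in S) r e / q))) => //.
  rewrite -ler_pdivrMr // mulr_suml; apply: ltW.
  apply: archi_boundP; apply: sumr_ge0 => e _.
  by rewrite divr_ge0 ?(ltW q0) //; case/andP: (r01 e).
elim: k r => [|k IHk] r r01 sumr.
(* If some candidate pair has less than [q] left, its term alone makes the potential at least 1, by
   the choice of [C] and by [1 <= G e], and the bound is trivial. *)
all: have [/existsP[u /andP[uc ruq]]|/existsPn rq] :=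
  boolP [exists u, (u \in cand) && (r (ed u) < q)].
- 1,3: apply: (@le_trans _ _ 0); last exact: Pr_ge0.
  1,2: rewrite subr_le0 /potential (le_trans Cq) // ler_wpM2l //.
  1,2: rewrite (bigD1 (ed u)) ?edS //= ler_wpDr //.
  1,3: by apply: sumr_ge0 => e /andP[eS _]; exact: term0.
  1,2: rewrite -[X in X <= _]mulr1 ler_pM ?expR_ge0 ?ler01 // ?G1 ?edS //.
  1,2: by rewrite ler_expR lerN2 ler_wpM2l // ltW.
- have [u uc] := card_gt0P cand0.
  have := rq u; rewrite uc /= -leNgt => qru.
  suff : r (ed u) <= 0 by move=> /(le_trans qru) /(lt_le_trans q0); rewrite ltxx.
  rewrite mulr0n mul0r in sumr; apply: le_trans sumr.
  rewrite (bigD1 (ed u)) ?edS //= ler_wpDr ?sumr_ge0 // => e _.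
  by case/andP: (r01 e).
have rq' u : u \in cand -> 0 <= q <= r (ed u).
  by move=> uc; have := rq u; rewrite uc /= -leNgt (ltW q0).
have step u : u \in cand ->
    q * (1 - potential r (G' u)) +
      (1 - q) * (1 - potential (lower r (ed u) q) G) <= Pr r A.
  move=> uc; apply: le_trans (Pr_expose r01 (rq' u uc) upA (upB u) _); last first.
    by move=> E; exact: BA.
  apply: lerD; apply: ler_wpM2l; rewrite ?subr_ge0 // ?(ltW q0) //; first exact: IHB.
  apply: IHk; first by apply: prob_vector_lower => //; exact: rq'.
  move: sumr; rewrite !(bigD1 (ed u) (edS u uc)) /= {1}/lower eqxx.
  have -> : \sum_(e in S | e != ed u) lower r (ed u) q e =
      \sum_(e in S | e != ed u) r e.
    by apply: eq_bigr => e /andP[_ eu]; rewrite /lower (negPf eu).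
  by rewrite -natr1; lra.
have nc0 : 0 < #|cand|%:R :> R by rewrite ltr0n.
rewrite -(ler_pM2l nc0).
have -> : #|cand|%:R * Pr r A = \sum_(u in cand) Pr r A.
  by rewrite sumr_const mulr_natl.
apply: le_trans (ler_sum _ step).
rewrite -subr_ge0.
(* The gain is collected pair by pair, with weight $q$ for success and $1-q$ for failure; each
   coefficient will be shown nonnegative. *)
have -> : \sum_(u in cand) (q * (1 - potential r (G' u)) +
      (1 - q) * (1 - potential (lower r (ed u) q) G)) -
     #|cand|%:R * (1 - potential r G) =
  C * \sum_(e in S) expR (- (lam * r e)) * (#|cand|%:R * G e -
    (q * \sum_(u in cand) G' u e +
    (1 - q) * \sum_(u in cand) expR (lam * q * (e == ed u)%:R) * G e)).
  rewrite /potential.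
  transitivity (\sum_(u in cand) C * \sum_(e in S) (expR (- (lam * r e)) *
      (G e - q * G' u e - (1 - q) * (expR (lam * q * (e == ed u)%:R) * G e)))).
    have -> : #|cand|%:R * (1 - C * \sum_(e in S) expR (- (lam * r e)) * G e) =
        \sum_(u in cand) (1 - C * \sum_(e in S) expR (- (lam * r e)) * G e).
      by rewrite sumr_const mulr_natl.
    rewrite -sumrB; apply: eq_bigr => u uc.
    under [in RHS]eq_bigr => e _ do rewrite !mulrBr (mulrCA _ q) (mulrCA _ (1 - q)).
    rewrite !sumrB -!mulr_sumr.
    have -> : \sum_(e in S) expR (- (lam * lower r (ed u) q e)) * G e =
      \sum_(e in S) expR (- (lam * r e)) * (expR (lam * q * (e == ed u)%:R) * G e).
      apply: eq_bigr => e _; rewrite mulrA -expRD /lower.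
      by case: eqP => [->|_] /=; rewrite ?mulr1n ?mulr0n; congr (expR _ * _); ring.
    ring.
  rewrite -mulr_sumr exchange_big /=; congr (C * _); apply: eq_bigr => e _.
  rewrite -mulr_sumr; congr (_ * _).
  rewrite !sumrB -!mulr_sumr sumr_const -mulr_natl; ring.
apply: mulr_ge0 => //; apply: sumr_ge0 => e eS; apply: mulr_ge0; first exact: expR_ge0.
have G0 : 0 <= G e by rewrite (le_trans _ (G1 e eS)).
have -> : \sum_(u in cand) expR (lam * q * (e == ed u)%:R) * G e =
    #|cand|%:R * G e + (e \in ed @: cand)%:R * ((expR (lam * q) - 1) * G e).
  rewrite -mulr_suml.
  have -> : \sum_(u in cand) expR (lam * q * (e == ed u)%:R) =
     \sum_(u in cand) (1 + (e == ed u)%:R * (expR (lam * q) - 1)).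
    by apply: eq_bigr => u _; case: eqP => _ /=; rewrite ?mulr1 ?mulr0 ?expR0; ring.
  rewrite big_split /= sumr_const -mulr_suml.
  have -> : \sum_(u in cand) (e == ed u)%:R = (e \in ed @: cand)%:R :> R.
    case: imsetP => [[u uc ->]|nu].
      rewrite (bigD1 u) //= eqxx big1 ?addr0 // => w /andP[wc wu].
      by case: eqP => // /ed_inj uw; rewrite uw ?eqxx in wu.
    rewrite big1 // => u uc; case: eqP => // eu; case: nu; by exists u.
  ring.
have := avgG e eS; set SG := \sum_(u in cand) _; set b := (_ \in _)%:R => avg.
have b0 : 0 <= b by rewrite ler0n.
have := ler_wpM2l (ltW q0) avg.
have := ler_wpM2l (mulr_ge0 b0 G0) thetaq.
nra.
Qed.

End Exposure.

(** * The random embedding of one tree *)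

Section RandomEmbedding.
Variables (R : realType) (V : finType) (v0 : V).
Variables (W : {set V}) (F : {set {set V}}) (par : nat -> nat) (gam : nat -> R).
Implicit Types (s : seq V) (e : {set V}).

Definition parent s := nth v0 s (par (size s)).

Definition star_edge s (u : V) : {set V} := [set u; parent s].

Definition candidates s : {set V} :=
  [set u in W | (u \notin s) && ((size s == 0)%N || (star_edge s u \notin F))].

Definition average (A : {set V}) (h : V -> R) : R := (\sum_(u in A) h u) / #|A|%:R.

(** The root has no parent to be joined to, so its step exposes nothing. *)
Definition hit e s : bool := (0 < size s)%N && (e \in star_edge s @: candidates s).

(* Positions [s] of the first tree vertices, [k] more to come: expectation of
   the product (resp. the sum) of the contributions of the future steps that
   may expose [e]. *)
Fixpoint growth (k : nat) s e : R :=
  if k is k'.+1 then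
    (1 + gam (size s) * (hit e s)%:R) *
      average (candidates s) (fun u => growth k' (rcons s u) e)
  else 1.

Fixpoint expected_hits (k : nat) s e : R :=
  if k is k'.+1 then
    gam (size s) * (hit e s)%:R +
      average (candidates s) (fun u => expected_hits k' (rcons s u) e)
  else 0.

Definition embedded s := uniq s /\ {subset s <= W}.

Lemma embedded_rcons s u : embedded s -> u \in candidates s -> embedded (rcons s u).
Proof.
move=> [us sW]; rewrite inE => /and3P[uW uns _]; split.
  by rewrite rcons_uniq uns.
by move=> x; rewrite mem_rcons inE => /predU1P[->|/sW].
Qed.

Lemma average_le (A : {set V}) (h : V -> R) (c : R) : 0 <= c ->
  (forall u, u \in A -> h u <= c) -> average A h <= c.
Proof.
move=> c0 hc; rewrite /average; have [A0|A0] := eqVneq #|A| 0%N.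
  by rewrite A0 invr0 mulr0.
rewrite ler_pdivrMr ?ltr0n ?lt0n // mulr_natr -sumr_const.
exact: ler_sum.
Qed.

Lemma ler_average (A : {set V}) (h1 h2 : V -> R) :
  (forall u, u \in A -> h1 u <= h2 u) -> average A h1 <= average A h2.
Proof. by move=> h12; rewrite ler_wpM2r ?invr_ge0 //; exact: ler_sum. Qed.

Lemma average_ge0 (A : {set V}) (h : V -> R) :
  (forall u, u \in A -> 0 <= h u) -> 0 <= average A h.
Proof. by move=> h0; rewrite mulr_ge0 ?invr_ge0 //; exact: sumr_ge0. Qed.

Variable m : nat.
Hypothesis gam_ge0 : forall t, 0 <= gam t.
Hypothesis par_lt : forall t, (0 < t < m)%N -> (par t < t)%N.

Lemma expected_hits_ge0 k s e : 0 <= expected_hits k s e.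
Proof.
elim: k s => [//|k IHk] s /=; apply: addr_ge0; first by rewrite mulr_ge0.
by apply: average_ge0 => u _; exact: IHk.
Qed.

Lemma hitP a b s : hit [set a; b] s -> (size s < m)%N ->
  (a = parent s /\ b \notin s) \/ (b = parent s /\ a \notin s).
Proof.
move=> /andP[s0 /imsetP[u]]; rewrite inE => /and3P[_ us _] abE sm.
have ps : parent s \in s by rewrite /parent mem_nth // par_lt // s0.
have uE : u \in [set a; b] by rewrite abE !inE eqxx.
have pE : parent s \in [set a; b] by rewrite abE !inE eqxx orbT.
have up : u != parent s by apply: contraNneq us => ->.
move: uE pE; rewrite !inE => /orP[]/eqP ua /orP[]/eqP pa.
- by rewrite ua pa eqxx in up.
- by right; rewrite -ua pa.
- by left; rewrite -ua pa.
- by rewrite ua pa eqxx in up.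
Qed.

(** Once [a] is occupied, a step can hit the pair only if it places a child of the tree vertex
    sitting at [a]. The index of that vertex does not change while [s] grows. *)
Lemma expected_hits_embedded k s a b : (size s + k <= m)%N -> embedded s ->
  a \in s ->
  expected_hits k s [set a; b] <=
    \sum_(size s <= t < size s + k) gam t * (par t == index a s)%:R.
Proof.
elim: k s => [|k IHk] s sm es as_ /=; first by rewrite addn0 big_geq.
have ssm : (size s < m)%N by lia.
rewrite big_ltn ?addnS ?ltnS ?leq_addr //; apply: lerD.
  apply: ler_wpM2l => //; rewrite ler_nat.
  case H: (hit _ _) => //=; rewrite lt0b; apply/eqP.
  have s0 : (0 < size s)%N by case/andP: H.
  case: (hitP H ssm) => [[ap _]|[_ /negP//]].
  by rewrite ap /parent index_uniq ?par_lt ?s0 //; case: es.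
apply: average_le => [|u uc]; first by rewrite sumr_ge0 // => t _; rewrite mulr_ge0.
apply: le_trans (IHk (rcons s u) _ _ _) _.
- by rewrite size_rcons addSnnS.
- exact: embedded_rcons.
- by rewrite mem_rcons inE as_ orbT.
rewrite size_rcons addSn; apply: ler_sum => t _.
by rewrite -cats1 index_cat as_.
Qed.

Lemma growth_ge0 k s e : 0 <= growth k s e.
Proof.
elim: k s => [//|k IHk] s /=.
apply: mulr_ge0; first by rewrite addr_ge0 // mulr_ge0.
by apply: average_ge0 => u _; exact: IHk.
Qed.

(** After a hit one end of the pair is occupied, so the later hits contribute at most [l] in
    expectation and the product of the factors $1+g_t$ is nearly linear. The induction step is
    $(1+g)(1+(1+\eta)L)\le 1+(1+\eta)(g+L)$, which for $g>0$ amounts to $(1+\eta)L\le\eta$. *)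
Lemma growth_le (eta l : R) k s a b : 0 <= eta -> (1 + eta) * l <= eta ->
  (forall i, \sum_(0 <= t < m) gam t * (par t == i)%:R <= l) ->
  (size s + k <= m)%N -> embedded s ->
  growth k s [set a; b] <= 1 + (1 + eta) * expected_hits k s [set a; b].
Proof.
move=> eta0 etal gaml; elim: k s => [|k IHk] s sm es /=; first by rewrite mulr0 addr0.
set e := [set a; b]; set g := gam (size s); set L := average _ (fun u => expected_hits _ _ _).
have L0 : 0 <= L by apply: average_ge0 => u _; exact: expected_hits_ge0.
have g0 : 0 <= g by exact: gam_ge0.
have GL : average (candidates s) (fun u => growth k (rcons s u) e) <= 1 + (1 + eta) * L.
  apply: le_trans (_ : average (candidates s)
     (fun u => 1 + (1 + eta) * expected_hits k (rcons s u) e) <= _).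
    apply: ler_average => u uc; apply: IHk; first by rewrite size_rcons addSnnS.
    exact: embedded_rcons.
  rewrite /average big_split /= mulrDl -mulr_sumr sumr_const -mulrA lerD2r.
  have [->|c0] := eqVneq #|candidates s| 0%N; first by rewrite mulr0n mul0r.
  by rewrite divff // pnatr_eq0.
apply: le_trans (ler_wpM2l _ GL) _; first by rewrite addr_ge0 ?mulr_ge0.
case H: (hit e s); last by rewrite !mulr0 addr0 mul1r add0r.
rewrite mulr1.
suff Ll : L <= l.
  have eL : (1 + eta) * L <= eta by apply: le_trans etal; rewrite ler_pM2l //; lra.
  by have := ler_wpM2l g0 eL; lra.
apply: average_le => [|u uc].
  apply: le_trans (gaml 0%N); rewrite sumr_ge0 // => t _; rewrite mulr_ge0 //.
have ssm : (size s < m)%N by lia.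
have s0 : (0 < size s)%N by case/andP: H.
have ps : parent s \in rcons s u.
  by rewrite mem_rcons inE /parent mem_nth ?orbT // par_lt // s0.
have sm' : (size (rcons s u) + k <= m)%N by rewrite size_rcons addSnnS.
have bnd x : \sum_(size (rcons s u) <= t < size (rcons s u) + k)
     gam t * (par t == x)%:R <= l.
  apply: le_trans (gaml x).
  rewrite (@big_cat_nat _ _ _ (size (rcons s u) + k) 0 m) //=.
  rewrite (@big_cat_nat _ _ _ (size (rcons s u)) 0 (size (rcons s u) + k)) ?leq_addr //=.
  by rewrite -addrA addrCA ler_wpDr // addr_ge0 // sumr_ge0 // => t _; rewrite mulr_ge0.
have [[ap _]|[bp _]] := hitP H ssm.
  rewrite -ap in ps; apply: le_trans (bnd _).
  by apply: expected_hits_embedded => //; exact: embedded_rcons.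
rewrite -bp in ps; rewrite /e setUC; apply: le_trans (bnd _).
by apply: expected_hits_embedded => //; exact: embedded_rcons.
Qed.

End RandomEmbedding.

(** * Probability that a given pair of vertices is hit *)

Section PairAvoidance.
Variables (R : realType) (V : finType) (v0 : V).
Variables (W : {set V}) (F : {set {set V}}) (par : nat -> nat) (gam : nat -> R).
Implicit Types (s : seq V) (e : {set V}).
Variables (m : nat) (A0 beta rho C1 : R) (X : {set V}).

Local Notation parent := (parent v0 par).
Local Notation star_edge := (star_edge v0 par).
Local Notation candidates := (candidates v0 W F par).
Local Notation hit := (hit v0 W F par).
Local Notation expected_hits := (expected_hits v0 W F par gam).

(** Free vertices of [W] after [t] steps. Below, [X] contains all vertices joined by a forbidden
    pair to one of two fixed vertices [a] and [b], and [C1] bounds the ratio of free vertices to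
    candidates. *)
Definition room (t : nat) : R := #|W|%:R - t%:R.

Hypothesis gam_ge0 : forall t, 0 <= gam t.
Hypothesis par_lt : forall t, (0 < t < m)%N -> (par t < t)%N.
Hypothesis A0_gt0 : 0 < A0.
Hypothesis card_candidates_ge : forall s, embedded W s -> (size s < m)%N ->
  A0 + 2 <= #|candidates s|%:R.
Hypothesis C1_ge : forall s, embedded W s -> (size s < m)%N ->
  room (size s) <= C1 * #|candidates s|%:R.
Hypothesis rho_ge0 : 0 <= rho.
Hypothesis card_X : #|X|%:R <= rho * A0.
Hypothesis beta_ge : 2 / A0 <= beta.
Hypothesis beta_degree : forall i,
  beta * \sum_(0 <= t < m) (par t == i)%:R <= 1 / 2.

Lemma beta_gt0 : 0 < beta.
Proof. by rewrite (lt_le_trans _ beta_ge) // divr_gt0. Qed.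

Lemma card_candidates_le s : embedded W s ->
  #|candidates s|%:R <= room (size s).
Proof.
move=> [us sW]; rewrite /room lerBrDr -natrD ler_nat.
have sWs : [set x in s] \subset W by apply/subsetP => x; rewrite inE => /sW.
have <- : #|[set x in s]| = size s by rewrite cardsE; exact/card_uniqP.
have : candidates s \subset W :\: [set x in s].
  by apply/subsetP => x; rewrite !inE => /and3P[-> -> _].
move=> /subset_leq_card; rewrite cardsD (finset.setIidPr sWs).
have := subset_leq_card sWs; lia.
Qed.

Lemma room_ge s : embedded W s -> (size s < m)%N -> A0 + 2 <= room (size s).
Proof.
by move=> es sm; apply: le_trans (card_candidates_ge es sm) (card_candidates_le es).
Qed.

(** The term of [later_weight] that the next step pays off. For [size s < m] the default [2 * rho]
    occurs only at the root. *)
Definition parent_weight s : R :=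
  if (par (size s) < size s)%N then (parent s \in X)%:R else 2 * rho.

Lemma parent_weight_ge0 s : 0 <= parent_weight s.
Proof. by rewrite /parent_weight; case: ifP => _; rewrite ?mulr_ge0. Qed.

(** From $e^{-x}\ge 1-x$ one gets $e^x\le 1/(1-x)\le 1+2x$. *)
Lemma expR_sub1_le (x : R) : 0 <= x <= 1 / 2 -> expR x - 1 <= 2 * x.
Proof.
move=> /andP[x0 x1]; have e0 := expR_gt0 x.
have := expR_ge1Dx (- x); rewrite expRN -div1r ler_pdivlMr //.
nra.
Qed.

(** Let $c$ be the number of candidates, $a$ that of free vertices and $k=|B|$. If the parent is
    outside [X], all of [B] is available and avoiding it has probability $(c-k)/c\le(a-k)/a$. If the
    parent is in [X], this probability is only bounded by 1, which $e^\beta(a-k)/a\ge1$ compensates.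
    The vertex [u] lands in [X] with probability at most $\rho$, which multiplies the weight by at
    most $1+2\beta d$; the last exponential covers this. *)
Lemma avoid_step s (B : {set V}) (d : R) : embedded W s -> (size s < m)%N ->
  (#|B| <= 2)%N -> B \subset W -> [disjoint B & s] ->
  ((0 < size s)%N -> parent s \notin X -> forall b, b \in B -> star_edge s b \notin F) ->
  0 <= d -> beta * d <= 1 / 2 ->
  \sum_(u in candidates s | u \notin B) expR (beta * d * (u \in X)%:R) <=
  #|candidates s|%:R * ((room (size s) - #|B|%:R) / room (size s)) *
    (expR (beta * parent_weight s) * expR (beta * (2 * rho * d))).
Proof.
move=> es sm B2 BW Bs BF d0 bd1.
have b0 := beta_gt0.
set a := room (size s); set c := #|candidates s|%:R; set k := #|B|%:R.
have ca : c <= a by exact: card_candidates_le.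
have cA : A0 + 2 <= c by exact: card_candidates_ge.
have k2 : k <= 2 by rewrite (ler_nat R _ 2).
have k0 : 0 <= k by exact: ler0n.
have c0 : 0 < c by apply: lt_le_trans cA; apply: addr_gt0.
have a0 : 0 < a by exact: lt_le_trans c0 ca.
have ck : A0 <= c - k by rewrite lerBrDr (le_trans _ cA) // lerD2l.
have ak : A0 <= a - k by apply: le_trans ck _; rewrite lerD2r.
have ck0 : 0 < c - k by exact: lt_le_trans ck.
have ak0 : 0 < a - k by exact: lt_le_trans ak.
have sumX : \sum_(u in candidates s | u \notin B) expR (beta * d * (u \in X)%:R) <=
   #|candidates s :\: B|%:R + #|X|%:R * (2 * (beta * d)).
  apply: le_trans (_ : \sum_(u in candidates s | u \notin B)
     (1 + (u \in X)%:R * (2 * (beta * d))) <= _).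
    apply: ler_sum => u _; case: (u \in X); rewrite ?mulr1 ?mulr0 ?mul0r ?mul1r ?expR0 ?addr0 //.
    have := @expR_sub1_le (beta * d); rewrite bd1 mulr_ge0 ?(ltW b0) // => /(_ isT).
    by rewrite lerBlDl.
  rewrite big_split /= -mulr_suml lerD //.
    rewrite -[#|_ :\: _|]sum1_card natr_sum le_eqVlt; apply/orP; left; apply/eqP.
    by apply: eq_bigl => u; rewrite !inE andbC.
  apply: ler_wpM2r; first by rewrite !mulr_ge0 // ltW.
  rewrite -sum1_card natr_sum big_mkcond [X in _ <= X]big_mkcond /=.
  by apply: ler_sum => u _; case: (u \in X); case: ifP.
have [PX|nPX] := boolP ((0 < size s)%N && (parent s \in X)).
  have /andP[s0 pX] := PX.
  have -> : parent_weight s = 1 by rewrite /parent_weight par_lt ?s0 //= pX.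
  have h1 : 1 <= (a - k) / a * expR (beta * 1).
    rewrite mulr1 mulrAC ler_pdivlMr ?mul1r; last by [].
    have := expR_ge1Dx beta => h.
    have : 2 <= beta * (a - k).
      apply: le_trans (_ : beta * A0 <= _); first by rewrite -ler_pdivrMr.
      by rewrite ler_pM2l.
    by have := ler_wpM2l (ltW ak0) h; lra.
  have h2 : c + c * (beta * (2 * rho * d)) <=
      c * expR (beta * (2 * rho * d)).
    by rewrite -[X in X + _]mulr1 -mulrDr ler_wpM2l ?expR_ge1Dx ?ltW.
  apply: le_trans sumX _.
  rewrite [X in _ <= X](_ : _ = ((a - k) / a * expR (beta * 1)) *
     (c * expR (beta * (2 * rho * d)))); last by ring.
  apply: le_trans (_ : c + c * (beta * (2 * rho * d)) <= _).
    apply: lerD; first by rewrite ler_nat subset_leq_card // subsetDl.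
    rewrite [X in _ <= X](_ : _ = (rho * c) * (2 * (beta * d))); last by ring.
    apply: ler_wpM2r; first by rewrite !mulr_ge0 // ltW.
    by apply: le_trans card_X _; apply: ler_wpM2l => //; apply: le_trans ck _; lra.
  by apply: le_trans h2 _; rewrite ler_peMl // mulr_ge0 ?expR_ge0 ?ltW.
have Bc : B \subset candidates s.
  apply/subsetP => b bB; rewrite inE (subsetP BW) //=.
  have -> /= : b \notin s by move: Bs; rewrite disjoint_subset => /subsetP /(_ b bB).
  have [//|s0] := eqVneq (size s) 0%N; rewrite /= BF ?lt0n //.
  by move: nPX; rewrite lt0n s0.
have cDB : #|candidates s :\: B|%:R = c - k.
  by rewrite cardsD (finset.setIidPr Bc) natrB ?subset_leq_card.
rewrite cDB in sumX.
have h1 : c - k <= c * ((a - k) / a).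
  rewrite mulrA ler_pdivlMr //.
  by have : k * c <= k * a by [apply: ler_wpM2l]; lra.
have h2 : 1 <= expR (beta * parent_weight s).
  by rewrite -[X in X <= _]expR0 ler_expR mulr_ge0 ?parent_weight_ge0 ?ltW.
have h3 : (c - k) + (c - k) * (beta * (2 * rho * d)) <=
      (c - k) * expR (beta * (2 * rho * d)).
  by rewrite -[X in X + _]mulr1 -mulrDr ler_wpM2l ?expR_ge1Dx ?ltW.
apply: le_trans sumX _.
apply: le_trans (_ : (c - k) * expR (beta * (2 * rho * d)) <= _).
  apply: le_trans h3; rewrite lerD2l.
  rewrite [X in _ <= X](_ : _ = (rho * (c - k)) * (2 * (beta * d))); last by ring.
  apply: ler_wpM2r; first by rewrite !mulr_ge0 // ltW.
  by apply: le_trans card_X _; apply: ler_wpM2l.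
rewrite [X in _ <= X]mulrA; apply: ler_wpM2r; first exact: expR_ge0.
by apply: le_trans h1 _; rewrite ler_peMr // mulr_ge0 ?divr_ge0 ?ltW.
Qed.




Hypothesis room_ge0 : forall t, (t < m)%N -> 0 <= room t.
Hypothesis C1_ge0 : 0 <= C1.

Definition later_weight T s : R := \sum_(size s <= i < T)
  (if (par i < size s)%N then (nth v0 s (par i) \in X)%:R else 2 * rho).

Definition later_children T t : R := \sum_(t.+1 <= i < T) (par i == t)%:R.

Lemma later_weight_rcons T s u : (size s < T)%N ->
  later_weight T (rcons s u) = later_weight T s - parent_weight s +
    later_children T (size s) * ((u \in X)%:R - 2 * rho).
Proof.
move=> sT; rewrite /later_weight size_rcons [in RHS]big_ltn //.
rewrite /parent_weight /parent [X in _ = X + _]addrAC subrr add0r.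
rewrite /later_children mulr_suml -big_split /=.
apply: eq_big_nat => i _; rewrite ltnS nth_rcons.
by case: ltngtP => _; rewrite ?mul0r ?mul1r ?addr0 // subrKC.
Qed.

(* Supermartingale majorizing the probability that the parent of vertex [T] sits
   at [a] while [b] is still unused when [T] gets placed. Without forbidden
   pairs it would be exact, with [C1 = 1] and no exponential; the exponential
   pays [beta] for each remaining step whose parent sits in [X], from where [a]
   or [b] might not be chosen, and [2 * beta * rho] for each step whose parent
   is not placed yet. *)
Definition occupation T a b s : R :=
  (if (par T < size s)%N then
     ((nth v0 s (par T) == a) && (b \notin s))%:R * (room T / room (size s))
   else ((a \notin s) && (b \notin s))%:R *
     (C1 * room T / (room (size s) * (room (size s) - 1)))) *
  expR (beta * later_weight T s).

Lemma occupation_ge0 T a b s : (T < m)%N -> embedded W s -> (size s < m)%N ->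
  0 <= occupation T a b s.
Proof.
move=> Tm es sm; rewrite /occupation mulr_ge0 ?expR_ge0 //.
have := room_ge es sm; have := A0_gt0 => A00 r2.
have r0 : 0 <= room (size s) by rewrite (le_trans _ r2) // addr_ge0 // ltW.
have r1 : 0 <= room (size s) - 1.
  by rewrite subr_ge0 (le_trans _ r2) // ler_wpDl ?ltW // ltr1n.
by case: ifP => _; rewrite mulr_ge0 // divr_ge0 ?mulr_ge0 ?room_ge0.
Qed.

Lemma later_children_ge0 T t : 0 <= later_children T t.
Proof. exact: sumr_ge0. Qed.

Lemma later_children_le T t : (T < m)%N -> beta * later_children T t <= 1 / 2.
Proof.
move=> Tm; apply: le_trans (beta_degree t); rewrite ler_pM2l ?beta_gt0 //.
rewrite /later_children; have [tT|Tt] := leqP t.+1 T; last first.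
  by rewrite big_geq ?sumr_ge0 // ltnW.
rewrite (@big_cat_nat _ _ _ T 0 m) ?(ltnW Tm) //= (@big_cat_nat _ _ _ t.+1 0 T) //=.
by rewrite -addrA addrCA ler_wpDr // addr_ge0 // sumr_ge0.
Qed.

Lemma room_succ t : room t.+1 = room t - 1.
Proof. by rewrite /room -natr1; ring. Qed.

(** The next vertex has to avoid [b] if the parent of [T] is already placed, and both [a] and [b] if
    that parent comes later. In both cases [avoid_step] produces the exponentials that
    [later_weight_rcons] takes away. *)
Lemma occupation_step T a b s : embedded W s -> (size s < T < m)%N ->
  a != b -> a \in W -> b \in W -> a \notin X ->
  (forall x, [set a; x] \in F -> x \in X) -> (forall x, [set b; x] \in F -> x \in X) ->
  \sum_(u in candidates s) occupation T a b (rcons s u) <=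
  #|candidates s|%:R * occupation T a b s.
Proof.
move=> es /andP[sT Tm] ab aW bW aX aFX bFX.
have sm : (size s < m)%N by exact: ltn_trans Tm.
have := parent_weight_ge0 s; have := room_ge es sm; have := A0_gt0.
have := later_children_ge0 T (size s); have := later_children_le (size s) Tm.
have := avoid_step es sm; have := later_weight_rcons _ sT.
have := room_ge0 Tm; have := C1_ge es sm.
under eq_bigr => u _ do rewrite /occupation size_rcons ltnS !mem_rcons !inE !negb_or room_succ.
rewrite /occupation; move: (later_children T (size s)) (later_weight T s) => d lw.
move: (parent_weight s) => pw.
set r := room (size s); set c := #|candidates s|%:R.
move=> C1r rT lwr avoid bd d0 A00 r2 pw0.
have r0 : 0 < r by rewrite (lt_le_trans _ r2) // addr_gt0.
have r10 : 0 < r - 1.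
  by rewrite subr_gt0 (lt_le_trans _ r2) // ltr_wpDl ?ltW // ltr1n.
have r20 : 0 < r - 2 by rewrite subr_gt0 (lt_le_trans _ r2) // ltrDr.
have c0 : 0 <= c by exact: ler0n.
have split_exp u : expR (beta * later_weight T (rcons s u)) =
    expR (beta * (lw - pw - 2 * rho * d)) * expR (beta * d * (u \in X)%:R).
  by rewrite lwr -expRD; congr expR; ring.
have [jt|tj|jt] := ltngtP (par T) (size s).
- have avoid1 := avoid [set b] d.
  have [/andP[/eqP sa bs]|nab] :=
    boolP ((nth v0 s (par T) == a) && (b \notin s)); last first.
    rewrite !mul0r mulr0 big1 // => u _; rewrite nth_rcons jt.
    by rewrite andbCA (negPf nab) andbF !mul0r.
  have -> : \sum_(u in candidates s)
      ((nth v0 (rcons s u) (par T) == a) && ((b != u) && (b \notin s)))%:R *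
       (room T / (r - 1)) * expR (beta * later_weight T (rcons s u)) =
    room T / (r - 1) * expR (beta * (lw - pw - 2 * rho * d)) *
      \sum_(u in candidates s | u \notin [set b]) expR (beta * d * (u \in X)%:R).
    rewrite mulr_sumr [RHS]big_mkcondr; apply: eq_bigr => u _.
    rewrite nth_rcons jt sa eqxx bs andbT inE split_exp eq_sym.
    by case: (u == b); rewrite ?mul0r ?mul1r // mulrA.
  apply: le_trans (ler_wpM2l _ (avoid1 _ _ _ _ d0 bd)) _.
  + by rewrite mulr_ge0 ?expR_ge0 // divr_ge0 // ltW.
  + by rewrite cards1.
  + by rewrite sub1set.
  + by rewrite disjoint_subset; apply/subsetP => x /set1P ->.
  + move=> _ pX x /set1P ->; apply: contra pX => bF; apply: bFX.
    by [].
  rewrite cards1 mul1r.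
  have -> : expR (beta * lw) = expR (beta * (lw - pw - 2 * rho * d)) *
      (expR (beta * pw) * expR (beta * (2 * rho * d))).
    by rewrite -!expRD; congr expR; ring.
  rewrite le_eqVlt; apply/orP; left; apply/eqP.
  field; apply/andP; split; exact: lt0r_neq0.
- have avoid2 := avoid [set a; b] d.
  have [/andP[as_ bs]|nab] := boolP ((a \notin s) && (b \notin s)); last first.
    rewrite !mul0r mulr0 big1 // => u _.
    by rewrite andbACA (negPf nab) andbF !mul0r.
  have -> : \sum_(u in candidates s)
      (((a != u) && (a \notin s)) && ((b != u) && (b \notin s)))%:R *
       (C1 * room T / ((r - 1) * (r - 1 - 1))) * expR (beta * later_weight T (rcons s u)) =
    C1 * room T / ((r - 1) * (r - 1 - 1)) * expR (beta * (lw - pw - 2 * rho * d)) *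
      \sum_(u in candidates s | u \notin [set a; b]) expR (beta * d * (u \in X)%:R).
    rewrite mulr_sumr [RHS]big_mkcondr; apply: eq_bigr => u _.
    rewrite as_ bs !andbT !inE split_exp negb_or (eq_sym a) (eq_sym b).
    by case: ((u != a) && _); rewrite ?mul0r ?mul1r // mulrA.
  have r11 : r - 1 - 1 = r - 2 by ring.
  rewrite r11; apply: le_trans (ler_wpM2l _ (avoid2 _ _ _ _ d0 bd)) _.
  + by rewrite mulr_ge0 ?expR_ge0 // divr_ge0 ?mulr_ge0 // ltW.
  + by rewrite cards2 ab.
  + by rewrite subUset !sub1set aW.
  + by rewrite disjoint_subset; apply/subsetP => x /set2P[] ->.
  + move=> _ pX x /set2P[] -> ; apply: contra pX; first exact: aFX.
    exact: bFX.
  rewrite cards2 ab /= mul1r.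
  have -> : expR (beta * lw) = expR (beta * (lw - pw - 2 * rho * d)) *
      (expR (beta * pw) * expR (beta * (2 * rho * d))).
    by rewrite -!expRD; congr expR; ring.
  rewrite le_eqVlt; apply/orP; left; apply/eqP.
  by field; rewrite !lt0r_neq0.
(* The next vertex is the parent of [T]: only [u = a] contributes, with probability at most $1/c\le
   C_1/r$, and the exponential does not grow because [a] is outside [X]. *)
rewrite jt.
have K0 : 0 <= room T * expR (beta * lw) by rewrite mulr_ge0 ?expR_ge0.
have [/andP[as_ bs]|nab] := boolP ((a \notin s) && (b \notin s)); last first.
  rewrite !mul0r mulr0 big1 // => u uc; rewrite nth_rcons ltnn eqxx.
  case: eqP => [ua|_]; last by rewrite !mul0r.
  suff -> : (b \notin s) = false by rewrite andbF !mul0r.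
  apply: contraNF nab => ->; rewrite andbT -ua.
  by move: uc; rewrite inE => /and3P[].
apply: le_trans (_ : \sum_(u in candidates s) (u == a)%:R *
    (room T / (r - 1) * expR (beta * lw)) <= _).
  apply: ler_sum => u uc; rewrite nth_rcons ltnn eqxx.
  case: eqP => [ua|_] /=; last by rewrite !mul0r.
  rewrite mul1r ua eq_sym ab bs mul1r; apply: ler_wpM2l.
    by rewrite divr_ge0 // ltW.
  rewrite ler_expR ler_pM2l ?beta_gt0 // -ua in aX *.
  rewrite lwr (negPf aX) -subr_ge0.
  have -> : lw - (lw - pw + d * (0 - 2 * rho)) = pw + d * (2 * rho) by ring.
  by rewrite addr_ge0 // !mulr_ge0.
rewrite -mulr_suml.
apply: le_trans (_ : 1 * (room T / (r - 1) * expR (beta * lw)) <= _).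
  apply: ler_wpM2r; first by rewrite mulr_ge0 ?divr_ge0 ?expR_ge0 // ltW.
  rewrite (bigID (pred1 a)) /= [X in _ + X]big1 ?addr0; last first.
    by move=> u /andP[_ /negPf ->].
  rewrite -natr_sum (ler_nat R _ 1).
  rewrite (eq_bigr (fun=> 1%N)) => [|u /andP[_ ->] //].
  rewrite sum1_card; apply: leq_trans (subset_leq_card (_ : _ \subset [set a])) _.
    by apply/subsetP => x /andP[_]; rewrite inE.
  by rewrite cards1.
rewrite !mul1r.
have -> : c * (C1 * room T / (r * (r - 1)) * expR (beta * lw)) =
  (room T / (r - 1) * expR (beta * lw)) * (C1 * c / r).
  by field; rewrite !lt0r_neq0.
rewrite ler_peMr //; first by rewrite mulr_ge0 ?divr_ge0 ?expR_ge0 // ltW.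
by rewrite ler_pdivlMr // mul1r.
Qed.

(** At [T = size s > 0] the parent of [T] is placed and no step remains in between, so [occupation]
    is the indicator that the parent sits at the first vertex while the second is free. *)
Lemma hit_le_occupation a b s : embedded W s -> (size s < m)%N ->
  (hit [set a; b] s)%:R <=
    occupation (size s) a b s + occupation (size s) b a s.
Proof.
move=> es sm; have occ0 x y := occupation_ge0 x y sm es sm.
case H: (hit _ _); last by rewrite addr_ge0.
have s0 : (0 < size s)%N by case/andP: H.
have occ1 x y : x = parent s -> y \notin s -> occupation (size s) x y s = 1.
  move=> xp ys; rewrite /occupation par_lt ?s0 // -/(parent s) -xp eqxx ys mul1r.
  rewrite /later_weight big_geq // mulr0 expR0 mulr1 divff // gt_eqF //.
  by rewrite (lt_le_trans _ (room_ge es sm)) // addr_gt0.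
have [[ap bs]|[bp as_]] := hitP par_lt H sm.
  by rewrite (occ1 _ _ ap bs) lerDl.
by rewrite (occ1 _ _ bp as_) lerDr.
Qed.

Lemma expected_hits_occupation k s a b : (size s + k <= m)%N -> embedded W s ->
  a != b -> a \in W -> b \in W -> a \notin X -> b \notin X ->
  (forall x, [set a; x] \in F -> x \in X) -> (forall x, [set b; x] \in F -> x \in X) ->
  expected_hits k s [set a; b] <= \sum_(size s <= T < size s + k)
    gam T * (occupation T a b s + occupation T b a s).
Proof.
move=> sm es ab aW bW aX bX aFX bFX; elim: k s sm es => [|k IHk] s sm es /=.
  by rewrite addn0 big_geq.
have ssm : (size s < m)%N by rewrite (leq_trans _ sm) // addnS ltnS leq_addr.
rewrite big_ltn ?addnS ?ltnS ?leq_addr //; apply: lerD.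
  by apply: ler_wpM2l => //; exact: hit_le_occupation.
have c0 : 0 < #|candidates s|%:R :> R.
  by rewrite (lt_le_trans _ (card_candidates_ge es ssm)) // addr_gt0.
apply: le_trans (_ : average (candidates s) (fun u =>
   \sum_((size s).+1 <= T < (size s + k).+1) gam T *
     (occupation T a b (rcons s u) + occupation T b a (rcons s u))) <= _).
  apply: ler_average => u uc; have := IHk (rcons s u).
  rewrite size_rcons addSn; apply; first by rewrite -addnS.
  exact: embedded_rcons es uc.
rewrite /average ler_pdivrMr // exchange_big /= mulr_suml.
rewrite !big_nat; apply: ler_sum => T /andP[sT Tsk].
have Tm : (T < m)%N by rewrite (leq_trans Tsk) // -addnS.
rewrite -mulr_sumr -mulrA; apply: ler_wpM2l => //.
rewrite big_split /= mulrDl ![_ * #|_|%:R]mulrC; apply: lerD.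
  by apply: occupation_step => //; rewrite sT.
by apply: occupation_step => //; rewrite 1?eq_sym ?sT.
Qed.

(** The value of the supermartingale at the empty embedding, for both orientations of the pair,
    whence the factor 2. If [gam T] is close to $\theta$ over [room T], the bound is about
    $2m\theta/n^2$. *)
Lemma expected_hits_le a b : (0 < m)%N ->
  a != b -> a \in W -> b \in W -> a \notin X -> b \notin X ->
  (forall x, [set a; x] \in F -> x \in X) -> (forall x, [set b; x] \in F -> x \in X) ->
  expected_hits m [::] [set a; b] <=
    2 * C1 * expR (2 * beta * rho * m%:R) / (#|W|%:R * (#|W|%:R - 1)) *
    \sum_(0 <= T < m) gam T * room T.
Proof.
move=> m0 ab aW bW aX bX aFX bFX.
have e0 : embedded W [::] by split.
apply: le_trans (expected_hits_occupation _ e0 ab aW bW aX bX aFX bFX) _ => //.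
rewrite mulr_sumr /= !big_nat; apply: ler_sum => T /andP[_ Tm].
rewrite add0n in Tm; have := room_ge e0 m0; rewrite /= => r2.
have r0 : 0 < room 0 by rewrite (lt_le_trans _ r2) // addr_gt0.
have r1 : 0 < room 0 - 1.
  by rewrite subr_gt0 (lt_le_trans _ r2) // ltr_wpDl ?ltW // ltr1n.
have W0 : #|W|%:R = room 0 by rewrite /room subr0.
have occ x y : occupation T x y [::] <=
    C1 * room T / (room 0 * (room 0 - 1)) * expR (2 * beta * rho * m%:R).
  rewrite /occupation /= mul1r; apply: ler_wpM2l.
    by rewrite divr_ge0 ?mulr_ge0 ?room_ge0 // ltW.
  have -> : later_weight T [::] = 2 * rho * T%:R.
    by rewrite /later_weight /= sumr_const_nat subn0 mulr_natr.
  rewrite ler_expR.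
  rewrite [X in _ <= X](_ : _ = beta * (2 * rho * m%:R)); last by ring.
  rewrite ler_pM2l ?beta_gt0 // ler_wpM2l ?mulr_ge0 // ler_nat.
  exact: ltnW.
rewrite W0 [X in _ <= X](_ : _ = gam T *
  (C1 * room T / (room 0 * (room 0 - 1)) * expR (2 * beta * rho * m%:R) +
   C1 * room T / (room 0 * (room 0 - 1)) * expR (2 * beta * rho * m%:R))).
  by apply: ler_wpM2l => //; exact: lerD.
by field; rewrite !lt0r_neq0.
Qed.

End PairAvoidance.

(** * Packing events *)

Section PackingEvents.
Variables (R : realType) (V : finType) (v0 : V).
Implicit Types (s : seq V) (e : {set V}) (E F : {set {set V}}).

(* Number of vertices and parent function of a tree whose vertices are numbered
   so that parents come first; the value at [0] is irrelevant. *)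
Definition code : Type := nat * (nat -> nat).

Definition edge_at (par : nat -> nat) s t : {set V} :=
  [set nth v0 s t; nth v0 s (par t)].

Definition tree_edges (par : nat -> nat) s : {set {set V}} :=
  [set e | [exists t : 'I_(size s), (0 < t)%N && (e == edge_at par s t)]].

Fixpoint packable (l : seq code) F E : Prop :=
  if l is c :: l' then
    exists s, [/\ uniq s, size s = c.1,
      forall t, (0 < t < c.1)%N -> edge_at c.2 s t \in E :\: F &
      packable l' (F :|: tree_edges c.2 s) E]
  else True.

Definition extendable (c : code) (l : seq code) F s E : Prop :=
  exists s', [/\ uniq s', size s' = c.1, take (size s) s' = s,
    forall t, (0 < t)%N -> (size s <= t < c.1)%N -> edge_at c.2 s' t \in E :\: F &
    packable l (F :|: tree_edges c.2 s') E].

Lemma up_closed_packable l F : up_closed (packable l F).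
Proof.
elim: l F => [|c l IHl] F E E' EE' //= [s [us ss Es Ps]].
exists s; split=> // [t tc|]; last exact: IHl Ps.
by have := Es t tc; rewrite !inE => /andP[-> /(subsetP EE') ->].
Qed.

Lemma up_closed_extendable c l F s : up_closed (extendable c l F s).
Proof.
move=> E E' EE' [s' [us ss ts Es Ps]]; exists s'; split=> // [t t0 tc|].
  by have := Es t t0 tc; rewrite !inE => /andP[-> /(subsetP EE') ->].
exact: up_closed_packable Ps.
Qed.

Lemma extendable_nil c l F E : extendable c l F [::] E -> packable (c :: l) F E.
Proof.
move=> [s' [us ss _ Es Ps]]; exists s'; split=> // t /andP[t0 tc].
by apply: Es => //=; rewrite tc.
Qed.

Lemma extendable_full c l F s E : uniq s -> size s = c.1 ->
  packable l (F :|: tree_edges c.2 s) E -> extendable c l F s E.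
Proof.
move=> us ss Ps; exists s; split=> //; first by rewrite take_size.
by move=> t _; rewrite ss; lia.
Qed.

Lemma extendable_rcons c l F s u E : (size s < c.1)%N ->
  (forall t, (0 < t < c.1)%N -> (c.2 t < t)%N) ->
  ((0 < size s)%N -> star_edge v0 c.2 s u \in E :\: F) ->
  extendable c l F (rcons s u) E -> extendable c l F s E.
Proof.
move=> sc par_lt suE [s' [us ss ts Es Ps]]; exists s'; split=> //.
  move: ts; rewrite size_rcons => /(congr1 (take (size s))).
  by rewrite take_takel // -cats1 take_size_cat.
move=> t t0 /andP[]; rewrite leq_eqVlt => /predU1P[st|st] tc; last first.
  by apply: Es; rewrite // size_rcons st.
rewrite size_rcons in ts.
have nths i : (i <= size s)%N -> nth v0 s' i = nth v0 (rcons s u) i.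
  by move=> si; rewrite -ts nth_take.
have pt := par_lt t; rewrite t0 tc in pt.
rewrite /edge_at !nths -?st //; last by rewrite st ltnW ?pt.
rewrite !nth_rcons ltnn eqxx st pt // -st.
by apply: suE; rewrite st.
Qed.

Definition pairs : {set {set V}} := [set e : {set V} | #|e| == 2]%N.

Lemma pairsP e : e \in pairs -> exists a b, a != b /\ e = [set a; b].
Proof. by rewrite inE => /cards2P [a [b ab]]; exists a, b. Qed.

Variables (C lam q theta : R).
Hypothesis q01 : 0 < q <= 1.
Hypothesis lam0 : 0 <= lam.
Hypothesis Cq : 1 <= C * expR (- (lam * q)).
Hypothesis thetaq : (1 - q) * (expR (lam * q) - 1) <= theta * q.

Local Notation pot := (potential pairs C lam).

Section OneTree.
Variables (W : {set V}) (F : {set {set V}}) (c : code) (l : seq code).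
Variables (gam : nat -> R) (M : R).
Local Notation m := c.1.
Local Notation par := c.2.
Local Notation growth := (growth v0 W F par gam).
Local Notation candidates := (candidates v0 W F par).

Hypothesis par_lt : forall t, (0 < t < m)%N -> (par t < t)%N.
Hypothesis gam_ge0 : forall t, 0 <= gam t.
Hypothesis card_gt0 : forall s, embedded W s -> (size s < m)%N ->
  (0 < #|candidates s|)%N.
Hypothesis gam_theta : forall s, embedded W s -> (size s < m)%N ->
  theta * (1 + gam (size s)) <= gam (size s) * #|candidates s|%:R.
Hypothesis M1 : 1 <= M.

Lemma growth_ge1 k s e : embedded W s -> (size s + k <= m)%N -> 1 <= growth k s e.
Proof.
elim: k s => [|k IHk] s es sm //=.
have ssm : (size s < m)%N by lia.
have c0 : 0 < #|candidates s|%:R :> R by rewrite ltr0n card_gt0.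
rewrite -[X in X <= _]mulr1; apply: ler_pM => //.
  by rewrite lerDl mulr_ge0.
rewrite /average ler_pdivlMr // mul1r -sum1_card natr_sum; apply: ler_sum => u uc.
by apply: IHk; [exact: embedded_rcons es uc|rewrite size_rcons addSnnS].
Qed.

(** [M] carries the weight of the later trees. Each step with a parent is an instance of
    [expose_until_success]; [gam_theta] makes the factor [1 + gam] of a hit pair large enough to
    yield the drop by [theta] demanded there. *)
Lemma Pr_extendable k s : (size s + k)%N = m -> embedded W s ->
  (forall s' r, uniq s' -> size s' = m -> {subset s' <= W} -> prob_vector r ->
     1 - pot r (fun=> M) <= Pr r (packable l (F :|: tree_edges par s'))) ->
  forall r, prob_vector r ->
    1 - pot r (fun e => M * growth k s e) <= Pr r (extendable c l F s).
Proof.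
move=> sk es IHl; elim: k s sk es => [|k IHk] s sk es r r01 /=.
  rewrite addn0 in sk; case: es => us sW.
  apply: le_trans (le_Pr r01 (fun E => @extendable_full c l F s E us sk)).
  rewrite (_ : potential _ _ _ _ _ = pot r (fun=> M)) ?IHl //.
  by rewrite /potential; under eq_bigr do rewrite mulr1.
have ssm : (size s < m)%N by lia.
have c0 := card_gt0 es ssm.
have c0r : 0 < #|candidates s|%:R :> R by rewrite ltr0n.
have IHk' u r' : u \in candidates s -> prob_vector r' ->
    1 - pot r' (fun e => M * growth k (rcons s u) e) <=
    Pr r' (extendable c l F (rcons s u)).
  move=> uc r'01; apply: IHk => //; first by rewrite size_rcons addSnnS.
  exact: embedded_rcons es uc.
(* At the root no pair is exposed, and averaging over its position is enough. *)
have [s0|s0] := posnP (size s).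
  have hit0 e : hit v0 W F par e s = false by rewrite /hit s0.
  rewrite -(ler_pM2l c0r).
  have -> : #|candidates s|%:R * Pr r (extendable c l F s) =
      \sum_(u in candidates s) Pr r (extendable c l F s).
    by rewrite sumr_const mulr_natl.
  apply: le_trans (_ : \sum_(u in candidates s)
      (1 - pot r (fun e => M * growth k (rcons s u) e)) <= _); last first.
    apply: ler_sum => u uc; apply: le_trans (IHk' u r uc r01) _.
    apply: le_Pr => // E; apply: extendable_rcons => //.
    by rewrite s0.
  rewrite sumrB sumr_const mulrBr mulr1 lerD2l lerN2 /potential -mulr_sumr.
  rewrite mulrCA le_eqVlt; apply/orP; left; apply/eqP; congr (C * _).
  rewrite exchange_big mulr_sumr; apply: eq_bigr => e _ /=.
  rewrite hit0 mulr0 addr0 mul1r -!mulr_sumr /average.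
  by field; rewrite gt_eqF.
apply: (expose_until_success c0 q01 lam0 Cq thetaq (ed := star_edge v0 par s)
  (B := fun u => extendable c l F (rcons s u))
  (G' := fun u e => M * growth k (rcons s u) e)) => //.
- move=> u u'; rewrite !inE => /and3P[_ us _] /and3P[_ us' _] uu'.
  have ps : parent v0 par s \in s by rewrite mem_nth // par_lt // s0.
  have : u \in star_edge v0 par s u' by rewrite -uu' !inE eqxx.
  by rewrite !inE => /orP[/eqP|/eqP up] //; rewrite up ps in us.
- move=> u; rewrite !inE => /and3P[_ us _].
  have ps : parent v0 par s \in s by rewrite mem_nth // par_lt // s0.
  by rewrite /star_edge cards2 (_ : u != _) //; apply: contraNneq us => ->.
- exact: up_closed_extendable.
- by move=> u; exact: up_closed_extendable.
- move=> u E uc Eu uE; apply: extendable_rcons Eu => // _.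
  by move: uc; rewrite !inE uE andbT => /and3P[_ _]; rewrite gtn_eqF.
- move=> e _; rewrite -[X in X <= _]mulr1 ler_pM //.
  by have := @growth_ge1 k.+1 s e es; rewrite sk => /(_ (leqnn _)).
move=> e _; rewrite -mulr_sumr -/(hit _ _ _ _ e s).
have -> : (e \in [set star_edge v0 par s x | x in candidates s]) = hit v0 W F par e s.
  by rewrite /hit s0.
rewrite /average; set Sg := \sum_(u in candidates s) growth k _ e.
have Sg0 : 0 <= Sg by apply: sumr_ge0 => u _; exact: growth_ge0.
have gt := gam_theta es ssm; have M0 : 0 <= M by rewrite (le_trans _ M1).
set cc := #|candidates s|%:R in c0r gt *; set g := gam (size s) in gt *.
case: (hit _ _ _ _ _ _); last first.
  rewrite mulr0 addr0 mul1r mul0r subr0 le_eqVlt; apply/orP; left; apply/eqP.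
  by field; rewrite gt_eqF.
rewrite mulr1 mul1r -subr_ge0.
rewrite [X in 0 <= X](_ : _ = M * (Sg / cc) * (g * cc - theta * (1 + g))).
  by rewrite !mulr_ge0 ?invr_ge0 ?subr_ge0 // ltW.
by field; rewrite gt_eqF.
Qed.

End OneTree.
End PackingEvents.

(** * Embedding the trees one after another *)

Section SequentialPacking.
Variables (R : realType) (V : finType) (v0 : V).
Implicit Types (s : seq V) (e : {set V}) (E F : {set {set V}}) (c : code).
Variables (dn A0 theta eta Delta mu w0 : R).

Definition forbidden F (v : V) : {set V} := [set x | [set v; x] \in F].

Definition low_degree F : {set V} := [set v | #|forbidden F v|%:R <= dn].

(** Handshake lemma: [forbidden F v] is the neighbourhood of [v] in the graph of used edges. *)
Lemma sum_forbidden F : F \subset pairs V ->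
  (\sum_v #|forbidden F v| <= 2 * #|F|)%N.
Proof.
move=> Fp; apply: (@leq_trans (\sum_v \sum_(e in F) (v \in e))%N).
  apply: leq_sum => v _.
  have inj : {in forbidden F v &, injective (fun x => [set v; x])}.
    move=> x y; rewrite !inE => /(subsetP Fp); rewrite inE cards2 => vx _ vxy.
    have : x \in [set v; y] by rewrite -vxy !inE eqxx orbT.
    by rewrite !inE => /orP[/eqP xv|/eqP//]; rewrite xv eqxx in vx.
  rewrite -(card_in_imset inj) -sum1_card big_mkcond [X in (_ <= X)%N]big_mkcond /=.
  apply: leq_sum => e _; case: imsetP => [[x]|//].
  by rewrite inE => vxF ->; rewrite vxF !inE eqxx.
rewrite exchange_big /= mulnC -sum_nat_const; apply: leq_sum => e eF.
have := subsetP Fp e eF; rewrite inE => /eqP <-.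
by rewrite -sum1_card [X in (_ <= X)%N]big_mkcond; apply: leq_sum => v _; case: ifP.
Qed.

(** Markov's inequality for the degrees in the graph of used edges. *)
Lemma card_low_degree F : F \subset pairs V -> 0 < dn ->
  #|V|%:R - 2 * #|F|%:R / dn <= #|low_degree F|%:R.
Proof.
move=> Fp dn0.
have h : #|~: low_degree F|%:R * dn <= 2 * #|F|%:R.
  rewrite -natrM; apply: le_trans (_ : (\sum_v #|forbidden F v|)%N%:R <= _).
    rewrite natr_sum mulrC mulr_natr -sumr_const big_mkcond /=; apply: ler_sum => v _.
    by case: ifP => //; rewrite !inE -ltNge => /ltW.
  by rewrite ler_nat; exact: sum_forbidden.
have := cardsC (low_degree F) => /(congr1 (fun k : nat => k%:R : R)).
rewrite natrD => VE; rewrite lerBlDr -VE lerD2l.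
by rewrite ler_pdivlMr.
Qed.

(** The child count includes the meaningless parent value at 0, so [Delta] may have to exceed the
    true number of children by one. *)
Definition code_ok c : Prop := [/\ (0 < c.1)%N, c.1%:R <= mu,
  forall t, (0 < t < c.1)%N -> (c.2 t < t)%N &
  forall i, \sum_(0 <= t < c.1) (c.2 t == i)%:R <= Delta].

(** Bounds the logarithm of the growth caused by one tree at any pair: $1+\eta$ times a uniform form
    of the bound in [expected_hits_le], with $C_1=1+dn/A_0$, $\beta=2/A_0$ and $\rho=2dn/A_0$. *)
Definition kappa : R :=
  (1 + eta) * (2 * (1 + dn / A0) * expR (2 * (2 / A0) * (2 * dn / A0) * mu) /
    (w0 * (w0 - 1)) * (mu * theta * (1 + (dn + theta) / A0))).

(** The solution $g$ of $\theta(1+g)=gc$, where $c$ is the lower bound [room R W t - dn] for the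
    number of candidates; set to 0 after the last step to be nonnegative throughout. *)
Definition exposure_rate (W : {set V}) (m t : nat) : R :=
  if (t < m)%N then theta / (room R W t - dn - theta) else 0.

Hypothesis A0_gt0 : 0 < A0.
Hypothesis dn_ge0 : 0 <= dn.
Hypothesis theta_ge0 : 0 <= theta.
Hypothesis eta_ge0 : 0 <= eta.
Hypothesis A0_le : A0 + 2 <= w0 - mu - dn - theta.
Hypothesis Delta_A0 : 4 * Delta <= A0.
Hypothesis Delta_theta : (1 + eta) * (Delta * theta) <= eta * A0.

Section OneTree.
Variables (F : {set {set V}}) (c : code).
Hypothesis F_pairs : F \subset pairs V.
Hypothesis c_ok : code_ok c.
Let W := low_degree F.
Hypothesis W_ge : w0 <= #|W|%:R.
Local Notation m := c.1.
Local Notation par := c.2.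
Let gam := exposure_rate W m.

Let par_lt t : (0 < t < m)%N -> (par t < t)%N.
Proof. by case: c_ok => _ _ + _; apply. Qed.

Let room_ge t : (t < m)%N -> A0 + 2 + dn + theta <= room R W t.
Proof.
move=> tm; have [_ mmu _ _] := c_ok.
have : t%:R <= m%:R :> R by rewrite ler_nat ltnW.
by rewrite /room; have := W_ge; have := A0_le; lra.
Qed.

Lemma exposure_rate_ge0 t : 0 <= gam t.
Proof.
rewrite /gam /exposure_rate; case: ifP => // tm; rewrite divr_ge0 //.
by have := room_ge tm; have := A0_gt0; lra.
Qed.

(** The parent sits in [W], so at most [dn] vertices are joined to it by used edges; the root loses
    none. *)
Lemma card_candidates_ge s : embedded W s -> (size s < m)%N ->
  room R W (size s) - dn <= #|candidates v0 W F par s|%:R.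
Proof.
move=> [us sW] sm.
have sWs : [set x in s] \subset W by apply/subsetP => x; rewrite inE => /sW.
have cs : #|[set x in s]| = size s by rewrite cardsE; exact/card_uniqP.
have Ws : #|W :\: [set x in s]|%:R = room R W (size s).
  rewrite cardsD (finset.setIidPr sWs) natrB; first by rewrite /room cs.
  exact: subset_leq_card.
have [s0|s0] := posnP (size s).
  rewrite -Ws -[X in _ <= X]subr0; apply: lerB => //.
  rewrite ler_nat; apply: subset_leq_card; apply/subsetP => x.
  by rewrite !inE s0 eqxx andbT andbC.
set v := parent v0 par s.
have vW : v \in W by apply: sW; rewrite mem_nth // par_lt // s0.
rewrite lerBlDr -Ws; apply: le_trans (_ : #|candidates v0 W F par s :|: forbidden F v|%:R <= _).
  rewrite ler_nat; apply: subset_leq_card; apply/subsetP => x.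
  rewrite !inE => /andP[-> ->] /=; rewrite gtn_eqF //= /star_edge -/v setUC.
  by rewrite orNb.
apply: le_trans (_ : (#|candidates v0 W F par s| + #|forbidden F v|)%N%:R <= _).
  by rewrite ler_nat cardsU leq_subr.
by rewrite natrD lerD2l; move: vW; rewrite inE.
Qed.

Lemma exposure_rate_theta s : embedded W s -> (size s < m)%N ->
  theta * (1 + gam (size s)) <= gam (size s) * #|candidates v0 W F par s|%:R.
Proof.
move=> es sm; have := card_candidates_ge es sm; have := room_ge sm.
rewrite /gam /exposure_rate sm; set r := room _ _ _; set k := #|_|%:R => r2 rk.
have d0 : 0 < r - dn - theta by have := A0_gt0; lra.
rewrite [X in X <= _](_ : _ = theta * (r - dn) / (r - dn - theta)); last first.
  by field; rewrite gt_eqF.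
rewrite [X in _ <= X]mulrAC; apply: ler_wpM2r; first by rewrite invr_ge0 ltW.
exact: ler_wpM2l.
Qed.

Lemma exposure_rate_le t : gam t <= theta / A0.
Proof.
rewrite /gam /exposure_rate; case: ifP => tm; last by rewrite divr_ge0 // ltW.
apply: ler_wpM2l => //; have := room_ge tm; have := A0_gt0 => A00 rg.
by rewrite lef_pV2 ?posrE //; lra.
Qed.

Lemma exposure_rate_room t : (t < m)%N ->
  gam t * room R W t <= theta * (1 + (dn + theta) / A0).
Proof.
move=> tm; rewrite /gam /exposure_rate tm; have := room_ge tm; have := A0_gt0.
set r := room _ _ _ => A00 rg.
rewrite -mulrA; apply: ler_wpM2l => //.
have d0 : 0 < r - dn - theta by lra.
rewrite [X in X <= _](_ : _ = 1 + (dn + theta) / (r - dn - theta)); last first.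
  by field; rewrite gt_eqF.
rewrite lerD2l; apply: ler_wpM2l; first exact: addr_ge0.
by rewrite lef_pV2 ?posrE //; lra.
Qed.

Lemma growth_no_hit k s e :
  (forall s', embedded W s' -> (size s' < m)%N -> hit v0 W F par e s' = false) ->
  (size s + k <= m)%N -> embedded W s -> growth v0 W F par gam k s e <= 1.
Proof.
move=> nohit; elim: k s => [|k IHk] s sm es //=.
rewrite nohit //; last by lia.
rewrite mulr0 addr0 mul1r; apply: average_le => // u uc.
by apply: IHk; [rewrite size_rcons addSnnS|exact: embedded_rcons es uc].
Qed.

Lemma kappa_ge0 : 0 <= kappa.
Proof.
have [m0 mmu _ _] := c_ok.
have mu0 : 0 <= mu by apply: le_trans mmu; rewrite ler0n.
have A00 := A0_gt0.
have w01 : 0 <= w0 - 1 by have := A0_le; have := dn_ge0; have := theta_ge0; lra.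
have w00 : 0 <= w0 by lra.
have dA : 0 <= 1 + dn / A0 by rewrite addr_ge0 // divr_ge0 // ltW.
have dA' : 0 <= 1 + (dn + theta) / A0.
  by rewrite addr_ge0 // divr_ge0 ?addr_ge0 // ltW.
rewrite /kappa; apply: mulr_ge0; first by rewrite addr_ge0.
by rewrite !mulr_ge0 // ?invr_ge0 ?mulr_ge0 ?expR_ge0.
Qed.

(** A used pair, or one with an end outside [W], is never hit. Otherwise take for [X] the vertices
    joined to either end by a used edge: at most [2 * dn] of them, as both ends have low degree. *)
Lemma growth_le_kappa e : e \in pairs V ->
  growth v0 W F par gam m [::] e <= expR kappa.
Proof.
move=> /pairsP[a [b [ab ->]]]; have A00 := A0_gt0.
have k1 : 1 <= expR kappa by rewrite -[X in X <= _]expR0 ler_expR kappa_ge0.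
have e0 : embedded W [::] by split.
have [abWF|nabWF] := boolP [&& a \in W, b \in W & [set a; b] \notin F]; last first.
  apply: le_trans k1; apply: growth_no_hit => // s [us sW] sm.
  apply/negP => /andP[s0 /imsetP[u uc abE]]; move/negP: nabWF; apply.
  move: (uc); rewrite inE => /and3P[uW _]; rewrite gtn_eqF //= -abE => ->.
  have pW : parent v0 par s \in W by apply: sW; rewrite mem_nth // par_lt // s0.
  have aE : a \in star_edge v0 par s u by rewrite -abE !inE eqxx.
  have bE : b \in star_edge v0 par s u by rewrite -abE !inE eqxx orbT.
  by case/set2P: aE => ->; case/set2P: bE => ->; rewrite ?uW ?pW.
have /and3P[aW bW abF] := abWF.
have [m0 mmu _ deg] := c_ok.
have selfF x : [set x; x] \notin F.
  by apply/negP => /(subsetP F_pairs); rewrite inE cards2 eqxx.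
have sum_gam i : \sum_(0 <= t < m) gam t * (par t == i)%:R <= Delta * theta / A0.
  apply: le_trans (_ : theta / A0 * \sum_(0 <= t < m) (par t == i)%:R <= _).
    rewrite mulr_sumr; apply: ler_sum => t _; apply: ler_wpM2r => //.
    exact: exposure_rate_le.
  rewrite [X in _ <= X](_ : _ = theta / A0 * Delta); last by ring.
  by apply: ler_wpM2l => //; rewrite divr_ge0 // ltW.
have eta_l : (1 + eta) * (Delta * theta / A0) <= eta.
  by rewrite mulrA ler_pdivrMr.
apply: le_trans (growth_le v0 F exposure_rate_ge0 par_lt a b eta_ge0 eta_l sum_gam _ e0) _ => //.
rewrite -/gam; apply: le_trans (expR_ge1Dx _); rewrite lerD2l /kappa.
apply: ler_wpM2l; first by rewrite addr_ge0.
set X := forbidden F a :|: forbidden F b.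
have cX : #|X|%:R <= 2 * dn / A0 * A0.
  rewrite divfK ?gt_eqF //.
  apply: le_trans (_ : (#|forbidden F a| + #|forbidden F b|)%N%:R <= _).
    by rewrite ler_nat cardsU leq_subr.
  by rewrite natrD mulr_natl mulr2n lerD //; move: aW bW; rewrite !inE.
have W0 : 0 < room R W 0.
  by have := room_ge m0; have := dn_ge0; have := theta_ge0; lra.
have bd i : 2 / A0 * \sum_(0 <= t < m) (par t == i)%:R <= 1 / 2.
  rewrite mulrAC ler_pdivrMr //; have := deg i; have := Delta_A0; lra.
have C1_ge s : embedded W s -> (size s < m)%N ->
    room R W (size s) <= (1 + dn / A0) * #|candidates v0 W F par s|%:R.
  move=> es sm; have := card_candidates_ge es sm; have := room_ge sm.
  set r := room _ _ _; set k := #|_|%:R => r2 rk.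
  have : dn <= dn / A0 * k.
    rewrite mulrAC ler_pdivlMr // ler_wpM2l //; have := theta_ge0; lra.
  by lra.
have cc_ge s : embedded W s -> (size s < m)%N ->
    A0 + 2 <= #|candidates v0 W F par s|%:R.
  move=> es sm; have := card_candidates_ge es sm; have := room_ge sm.
  by have := theta_ge0; lra.
apply: le_trans (expected_hits_le (X := X) exposure_rate_ge0 par_lt A0_gt0 cc_ge
  C1_ge _ cX (lexx _) bd _ _ m0 ab aW bW _ _ _ _) _.
- by rewrite divr_ge0 ?mulr_ge0 // ltW.
- by move=> t tm; have := room_ge tm; have := dn_ge0; have := theta_ge0; lra.
- by rewrite addr_ge0 // divr_ge0 // ltW.
- by rewrite !inE negb_or selfF setUC abF.
- by rewrite !inE negb_or selfF abF.
- by move=> x; rewrite !inE => ->.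
- by move=> x; rewrite !inE => ->; rewrite orbT.
have mu0 : 0 <= mu by apply: le_trans mmu; rewrite ler0n.
have w01 : 0 < w0 - 1.
  by have := A0_le; have := dn_ge0; have := theta_ge0; lra.
have W_ge' := W_ge.
have dA : 0 <= 1 + dn / A0 by rewrite addr_ge0 // divr_ge0 // ltW.
have W1 : 0 < #|W|%:R - 1 :> R by lra.
have W00 : 0 < #|W|%:R :> R by lra.
apply: ler_pM.
- by rewrite !mulr_ge0 ?invr_ge0 ?mulr_ge0 ?expR_ge0 // ltW.
- apply: sumr_ge0 => t _; rewrite -/gam; have [tm|mt] := ltnP t m.
    rewrite mulr_ge0 ?exposure_rate_ge0 //; have := room_ge tm.
    by have := dn_ge0; have := theta_ge0; lra.
  by rewrite /gam /exposure_rate ltnNge mt mul0r.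
- apply: ler_pM; rewrite ?invr_ge0 ?mulr_ge0 ?expR_ge0 ?(ltW W1) //.
    apply: ler_wpM2l; first by rewrite mulr_ge0.
    rewrite ler_expR; apply: ler_wpM2l => //.
    by rewrite !mulr_ge0 ?invr_ge0 // ltW.
  rewrite lef_pV2 ?posrE ?mulr_gt0 //; last by lra.
  by apply: ler_pM => //; lra.
rewrite big_nat; apply: le_trans (_ : \sum_(0 <= t < m)
     theta * (1 + (dn + theta) / A0) <= _).
  by rewrite [X in _ <= X]big_nat; apply: ler_sum => t /andP[_ tm]; exact: exposure_rate_room.
rewrite sumr_const_nat subn0 -mulr_natl -mulrA; apply: ler_wpM2r => //.
by rewrite mulr_ge0 // addr_ge0 // divr_ge0 ?addr_ge0 // ltW.
Qed.

End OneTree.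
Lemma tree_edges_pairs c s : code_ok c -> uniq s -> size s = c.1 ->
  tree_edges v0 c.2 s \subset pairs V.
Proof.
move=> [_ _ par_lt _] us ss; apply/subsetP => e; rewrite inE.
move=> /existsP[t /andP[t0 /eqP ->]]; have tc : (t < c.1)%N by rewrite -ss.
have pt : (c.2 t < t)%N by apply: par_lt; rewrite t0.
have ct : (c.2 t < size s)%N by exact: ltn_trans pt (ltn_ord t).
have ne : nth v0 s t != nth v0 s (c.2 t).
  rewrite nth_uniq //; apply/eqP => tE.
  by rewrite -tE ltnn in pt.
by rewrite inE /edge_at cards2 ne.
Qed.

Lemma card_tree_edges par s : (#|tree_edges v0 par s| <= size s)%N.
Proof.
rewrite -[X in (_ <= X)%N]card_ord.
apply: leq_trans (leq_imset_card (fun t : 'I_(size s) => edge_at v0 par s t) _).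
apply: subset_leq_card; apply/subsetP => e; rewrite inE => /existsP[t /andP[_ /eqP ->]].
exact: imset_f.
Qed.

Variables (C lam q fmax : R).
Hypothesis q01 : 0 < q <= 1.
Hypothesis lam0 : 0 <= lam.
Hypothesis Cq : 1 <= C * expR (- (lam * q)).
Hypothesis thetaq : (1 - q) * (expR (lam * q) - 1) <= theta * q.
Hypothesis dn_gt0 : 0 < dn.
Hypothesis w0_le : w0 <= #|V|%:R - 2 * fmax / dn.

(** Each tree costs a factor of at most $e^\kappa$ at every pair, and as long as at most [fmax]
    edges are used, [w0] vertices keep low degree. *)
Lemma Pr_packable (l : seq code) F r : F \subset pairs V ->
  List.Forall code_ok l -> #|F|%:R + (size l)%:R * mu <= fmax -> prob_vector r ->
  1 - potential (pairs V) C lam r (fun=> expR (kappa * (size l)%:R)) <=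
    Pr r (packable v0 l F).
Proof.
have C0 : 0 <= C.
  by rewrite -(pmulr_lge0 _ (expR_gt0 (- (lam * q)))) (le_trans _ Cq).
elim: l F r => [|c l IHl] F r Fp l_ok Fl r01.
  rewrite Pr_true lerBlDr lerDl; apply: mulr_ge0 => //; apply: sumr_ge0 => e _.
  by rewrite mulr_ge0 ?expR_ge0.
have [c_ok l_ok'] : code_ok c /\ List.Forall code_ok l.
  by split; [exact: List.Forall_inv l_ok|exact: List.Forall_inv_tail l_ok].
have [m0 mmu par_lt deg] := c_ok.
have mu0 : 0 <= mu by apply: le_trans mmu; rewrite ler0n.
have W_ge : w0 <= #|low_degree F|%:R.
  apply: le_trans (card_low_degree Fp dn_gt0); apply: le_trans w0_le _.
  rewrite lerD2l lerN2 ler_pM2r ?invr_gt0 // ler_pM2l //.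
  by apply: le_trans Fl; rewrite lerDl mulr_ge0.
have k0 := kappa_ge0 c_ok.
have e0 : embedded (low_degree F) [::] by split.
have := @Pr_extendable R V v0 C lam q theta q01 lam0 Cq thetaq (low_degree F) F c l
  (exposure_rate (low_degree F) c.1) (expR (kappa * (size l)%:R)) par_lt
  (exposure_rate_ge0 c_ok W_ge) _ (exposure_rate_theta c_ok W_ge) _ c.1 [::] _ e0.
move=> ext; apply: (@le_trans _ _ (Pr r (extendable v0 c l F [::]))); last first.
  by apply: le_Pr => // E; exact: extendable_nil.
have card_gt0 s : embedded (low_degree F) s -> (size s < c.1)%N ->
    (0 < #|candidates v0 (low_degree F) F c.2 s|)%N.
  move=> es sm; rewrite -(ltr_nat R).
  have := card_candidates_ge c_ok es sm; apply: lt_le_trans.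
  rewrite /room; have : (size s)%:R <= c.1%:R :> R by rewrite ler_nat ltnW.
  by move: mmu W_ge; have := A0_le; have := A0_gt0; have := theta_ge0; lra.
have M1 : 1 <= expR (kappa * (size l)%:R).
  by rewrite -[X in X <= _]expR0 ler_expR mulr_ge0.
apply: le_trans (ext card_gt0 M1 (add0n _) _ r r01); last first.
  move=> s' r' us' ss' _ r'01; apply: IHl => //.
    by rewrite subUset Fp tree_edges_pairs.
  apply: le_trans Fl; rewrite /= -natr1.
  have : #|F :|: tree_edges v0 c.2 s'|%:R <= #|F|%:R + c.1%:R :> R.
    rewrite -natrD ler_nat -ss'; apply: leq_trans (leq_add (leqnn _) (card_tree_edges c.2 s')).
    by rewrite cardsU leq_subr.
  by move: mmu; lra.
rewrite lerD2l lerN2 /potential; apply: ler_wpM2l => //; apply: ler_sum => e ep.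
apply: ler_wpM2l; first exact: expR_ge0.
rewrite /= -natr1 mulrDr mulr1 expRD; apply: ler_wpM2l; first exact: expR_ge0.
exact: growth_le_kappa.
Qed.

End SequentialPacking.

(** * Colour classes *)

Section Grouping.
Variables (R : realType) (V : finType) (v0 : V).
Implicit Types (E F : {set {set V}}) (l : seq code).

Lemma packable_used l F F' E : (forall e, e \in E -> e \in F' -> e \in F) ->
  packable v0 l F E -> packable v0 l F' E.
Proof.
elim: l F F' => [|c l IHl] F F' FF' //= [s [us ss Es Ps]].
exists s; split=> // [t tc|].
  have := Es t tc; rewrite !inE => /andP[eF eE]; rewrite eE andbT.
  by apply: contra eF; exact: FF'.
apply: IHl Ps => e eE; rewrite !inE => /orP[/(FF' _ eE) -> //|->].
exact: orbT.
Qed.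

(** The edges used by the first list lie in [F] or [E1], hence do not disturb the second list inside
    [E2]. *)
Lemma packable_cat l1 l2 F E1 E2 : F :&: E2 = set0 -> E1 :&: E2 = set0 ->
  packable v0 l1 F E1 -> packable v0 l2 set0 E2 ->
  packable v0 (l1 ++ l2) F (E1 :|: E2).
Proof.
move=> FE2 E12; elim: l1 F FE2 => [|c l IHl] F FE2 /= P1 P2.
  apply: (up_closed_packable (subsetUr E1 E2)); apply: packable_used P2 => e eE eF.
  by rewrite -FE2 inE eF eE.
have [s [us ss Es Ps]] := P1; exists s; split=> // [t tc|].
  by have := Es t tc; rewrite !inE => /andP[-> ->].
apply: IHl => //; apply/setP => e; rewrite !inE.
apply/negP => /andP[/orP[eF|/existsP[t /andP[t0 /eqP eE]]] eE2].
  by have := finset.in_set0 e; rewrite -FE2 inE eF eE2.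
have tc : (0 < t < c.1)%N by rewrite t0 -ss ltn_ord.
have := Es t tc; rewrite !inE -eE => /andP[_ eE1].
by have := finset.in_set0 e; rewrite -E12 inE eE1 eE2.
Qed.

(** Each group of at most [N] trees gets a colour of its own. A pair takes at most one colour, each
    with probability [r e], and the errors add up by the union bound. *)
Lemma Pr_packable_groups (P : code -> Prop) (r : {set V} -> R) (N K : nat)
    (err : R) l : (forall e, 0 <= r e) -> (forall e, K%:R * r e <= 1) ->
  (forall l', List.Forall P l' -> (size l' <= N)%N ->
    1 - err <= Pr r (packable v0 l' set0)) ->
  List.Forall P l -> (size l <= K * N)%N ->
  1 - K%:R * err <= Pr (fun e => K%:R * r e) (packable v0 l set0).
Proof.
move=> r0 + prN; elim: K l => [|K IHK] l r1 lP lN.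
  by case: l lP lN => //= _ _; rewrite Pr_true mul0r subr0.
have r1' e : K%:R * r e <= 1.
  by apply: le_trans (r1 e); rewrite ler_wpM2r // ler_nat.
have [lP1 lP2] : List.Forall P (take N l) /\ List.Forall P (drop N l).
  elim: l N lP {IHK prN lN} => [|c l IHl] [|N] lP //=.
  have [] := IHl N (List.Forall_inv_tail lP); split=> //.
  exact: (List.Forall_cons _ (List.Forall_inv lP)).
have h1 : 1 - err <= Pr r (packable v0 (take N l) set0).
  by apply: prN => //; rewrite size_take_min geq_minl.
have h2 : 1 - K%:R * err <= Pr (fun e => K%:R * r e) (packable v0 (drop N l) set0).
  by apply: IHK => //; rewrite size_drop leq_subLR -mulSn.
have -> : (fun e => K.+1%:R * r e) = (fun e => r e + K%:R * r e).
  by apply/funext => e; rewrite -natr1; ring.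
apply: le_trans (Pr_disjoint_union (A := packable v0 (take N l) set0)
  (B := packable v0 (drop N l) set0) r0 _ _ _).
- by rewrite -natr1; move: h1 h2; lra.
- by move=> e; rewrite mulr_ge0.
- by move=> e; apply: le_trans (r1 e); rewrite -natr1 mulrDl mul1r addrC.
- move=> E1 E2 E12 P1 P2; rewrite -[l](cat_take_drop N).
  by apply: packable_cat => //; rewrite set0I.
Qed.

End Grouping.

(** * The binomial random graph as a product measure *)

Section BinomialGraph.
Variables (R : realType) (n : nat).

(** The product measure lives on all sets of vertices; those that are not pairs get probability
    0. *)
Definition edge_prob (p : R) (e : {set 'I_n}) : R :=
  if e \in possible_edges n then p else 0.

Lemma gnp_probE (p : R) (A : graph -> Prop) :
  gnp_prob n p A = Pr (edge_prob p) (fun E => A (graph_of_edges E)).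
Proof.
rewrite /gnp_prob /Pr [RHS](bigID (fun E => E \in powerset (possible_edges n))) /=.
rewrite [X in _ = _ + X]big1 ?addr0; last first.
  move=> E; rewrite powersetE => /subsetPn[e eE ne].
  by rewrite /wt (bigD1 e) //= eE /edge_prob (negPf ne) !mul0r.
rewrite big_mkcondr /=; apply: eq_bigr => E; rewrite powersetE => EP.
have -> : wt (edge_prob p) E = gnp_weight p E.
  rewrite /wt /gnp_weight [RHS]big_mkcond; apply: eq_bigr => e _.
  rewrite /edge_prob; case: (boolP (e \in possible_edges n)) => // ne.
  by rewrite subr0 ifF //; apply: contraNF ne; exact: (subsetP EP).
by case: `[<_>]; rewrite ?mulr1 ?mulr0.
Qed.

End BinomialGraph.

(** * Trees *)

Section TreeCodes.
Variable G : graph.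
Implicit Types (x y z : G) (e : seq G).

Definition within e : rel G := [rel x y | [&& adj x y, x \in e & y \in e]].

Definition coded (x0 : G) e (par : nat -> nat) : Prop :=
  [/\ uniq e,
      forall t, (0 < t < size e)%N -> (par t < t)%N,
      forall t, (0 < t < size e)%N -> adj (nth x0 e (par t)) (nth x0 e t) &
      forall x y, x \in e -> y \in e -> adj x y ->
        exists2 t, (0 < t < size e)%N & [set x; y] = [set nth x0 e t; nth x0 e (par t)]].

Lemma within_path_mem e x p : x \in e -> path (within e) x p -> {subset p <= e}.
Proof.
elim: p x => [//|y p IHp] x xe /= /andP[/and3P[_ _ ye] yp] z.
by rewrite inE => /predU1P[-> //|]; exact: IHp ye yp z.
Qed.

(** If [y] and [z] were different, a simple path between them inside [e], closed through the outside
    vertex [x], would be a cycle of length at least 3. *)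
Lemma acyclic_one_neighbor e x y z : acyclic_graph G -> x \notin e -> y \in e ->
  connect (within e) y z -> adj x y -> adj x z -> y = z.
Proof.
move=> ac xe ye /connectP[p0 p0P ->] xy.
case: (shortenP p0P) => [[//|w p]] pP pu _ xz.
have sub : {subset w :: p <= e} by exact: within_path_mem ye pP.
have adjP : path (@adj G) y (w :: p).
  by apply: sub_path pP => a b /and3P[].
suff /ac : ucycle (@adj G) (x :: y :: w :: p) by [].
have cycleE : cycle (@adj G) (x :: y :: w :: p) =
    [&& adj x y, path (@adj G) y (w :: p) & adj (last y (w :: p)) x].
  by rewrite /= rcons_path !andbA.
rewrite /ucycle cycleE xy adjP adj_sym xz /= -[_ && _ in X in _ && X]/(uniq (y :: w :: p)).
rewrite pu andbT; apply: contra xe; rewrite inE => /predU1P[-> //|].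
exact: sub.
Qed.

Lemma within_rcons e w x y : within e x y -> within (rcons e w) x y.
Proof. by move=> /and3P[xy xe ye]; rewrite /within /= xy !mem_rcons !inE xe ye !orbT. Qed.

(** The numbering grows by a vertex adjacent to a numbered one: connectedness provides it, and
    acyclicity leaves it a single numbered neighbour, its parent. The latter needs connectedness
    inside [e], which is therefore carried along. *)
Lemma partial_code (x0 : G) k : is_tree G -> (0 < k <= #|G|)%N ->
  exists e par, [/\ size e = k, coded x0 e par &
    {in e &, forall x y, connect (within e) x y}].
Proof.
move=> [[_ conn] ac]; elim: k => [//|[|k] IHk] kG.
  exists [:: x0], (fun=> 0%N); split=> //.
  - split=> //; try by move=> [|[|t]].
    by move=> x y; rewrite !inE => /eqP -> /eqP ->; rewrite adj_irr.
  - by move=> x y; rewrite !inE => /eqP -> /eqP ->; exact: connect0.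
have [|e [par [se [ue par_lt par_adj cover] ce]]] := IHk.
  by move: kG; rewrite /= => /ltnW ->.
have [x [y [xe ye xy]]] : exists x y, [/\ x \notin e, y \in e & adj x y].
  have x0e : (0 < size e)%N by rewrite se.
  have [w we] : exists w, w \notin e.
    apply/existsP; rewrite -negb_forall; apply/negP => /forallP all_e.
    have : (#|G| <= size e)%N.
      by rewrite -(card_uniqP ue); apply: subset_leq_card; apply/subsetP => w _; exact: all_e.
    by rewrite se leqNgt; case/andP: kG => _ ->.
  (* On a walk from a numbered to an unnumbered vertex, the first edge leaving [e] is the one
     sought. *)
  have /connectP[p pP pw] := conn (nth x0 e 0) w.
  have : nth x0 e 0 \in e by rewrite mem_nth.
  elim: p (nth x0 e 0) pP pw => [|v p IHp] u /=.
    by move=> _ wu ue'; rewrite wu ue' in we.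
  move=> /andP[uv vp] pw ue'; have [ve|ve] := boolP (v \in e).
    exact: IHp vp pw ve.
  by exists v, u; split=> //; rewrite adj_sym.
have only z : z \in e -> adj x z -> z = y.
  by move=> ze xz; apply/esym; exact: acyclic_one_neighbor ac xe ye (ce y z ye ze) xy xz.
pose par' t := if t == size e then index y e else par t.
have parE t : (t < size e)%N -> par' t = par t by move=> te; rewrite /par' ltn_eqF.
have parS : par' (size e) = index y e by rewrite /par' eqxx.
have iy : (index y e < size e)%N by rewrite index_mem.
have nthl i : (i < size e)%N -> nth x0 (rcons e x) i = nth x0 e i.
  by move=> ie; rewrite nth_rcons ie.
have nthS : nth x0 (rcons e x) (size e) = x by rewrite nth_rcons ltnn eqxx.
exists (rcons e x), par'; split; first by rewrite size_rcons se.
- split.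
  + by rewrite rcons_uniq xe.
  + move=> t; rewrite size_rcons ltnS => /andP[t0]; rewrite leq_eqVlt => /predU1P[->|te].
      by rewrite parS.
    by rewrite parE // par_lt // t0.
  + move=> t; rewrite size_rcons ltnS => /andP[t0]; rewrite leq_eqVlt => /predU1P[->|te].
      by rewrite parS nthS nthl // nth_index // adj_sym.
    have pt : (par t < t)%N by rewrite par_lt // t0.
    rewrite parE // !nthl ?(ltn_trans pt te) //.
    by apply: par_adj; rewrite t0.
  + have old a b : a \in e -> b \in e -> adj a b ->
        exists2 t, (0 < t < size (rcons e x))%N &
          [set a; b] = [set nth x0 (rcons e x) t; nth x0 (rcons e x) (par' t)].
      move=> ae be ab; have [t /andP[t0 te] abE] := cover a b ae be ab.
      have pt : (par t < t)%N by rewrite par_lt // t0.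
      exists t; first by rewrite size_rcons t0 ltnW.
      by rewrite parE // !nthl ?(ltn_trans pt te).
    have new : exists2 t, (0 < t < size (rcons e x))%N &
          [set x; y] = [set nth x0 (rcons e x) t; nth x0 (rcons e x) (par' t)].
      exists (size e); first by rewrite size_rcons se ltnSn.
      by rewrite parS nthS nthl // nth_index.
    move=> a b; rewrite !mem_rcons !inE => /predU1P[->|ae] /predU1P[->|be] ab.
    * by rewrite adj_irr in ab.
    * by rewrite (only b be ab).
    * by rewrite setUC; rewrite adj_sym in ab; rewrite (only a ae ab).
    * exact: old.
have cx z : z \in e -> connect (within (rcons e x)) x z.
  move=> ze; apply: (@connect_trans _ _ y).
    by apply: connect1; rewrite /within /= xy !mem_rcons !inE eqxx ye orbT.
  by apply: connect_sub (ce y z ye ze) => a b ab; apply: connect1; exact: within_rcons.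
have wsym : symmetric (within (rcons e x)).
  by move=> a b; rewrite /within /= adj_sym andbA andbAC -andbA.
have csym := sym_connect_sym wsym.
move=> a b; rewrite !mem_rcons !inE => /predU1P[->|ae] /predU1P[->|be].
- exact: connect0.
- exact: cx.
- by rewrite csym; exact: cx.
- by apply: connect_sub (ce a b ae be) => u v uv; apply: connect1; exact: within_rcons.
Qed.

Lemma tree_code : is_tree G -> exists x0 e par,
  [/\ coded x0 e par, size e = #|G| & forall x : G, x \in e].
Proof.
move=> Gtree; have [[G0 _] _] := Gtree.
have [x0 _] := card_gt0P G0.
have [|e [par [se ce _]]] := partial_code x0 (k := #|G|) Gtree; first by rewrite G0 leqnn.
exists x0, e, par; split=> //.
have [ue _ _ _] := ce.
by apply/subset_cardP/subset_predT; rewrite (card_uniqP ue) se.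
Qed.

(** Distinct children sit at distinct neighbours. The sum starts at 1 because the root has no
    parent. *)
Lemma coded_degree (x0 : G) e par i : coded x0 e par ->
  (\sum_(1 <= t < size e) (par t == i) <= max_degree G)%N.
Proof.
move=> [ue par_lt par_adj _].
have [ie|ei] := ltnP i (size e); last first.
  rewrite big_nat big1 // => t /andP[t0 te].
  by rewrite ltn_eqF // (leq_trans (par_lt t _)) ?t0 // (leq_trans (ltnW te)).
apply: (@leq_trans (degree (nth x0 e i))); last first.
  by rewrite /max_degree (bigD1 (nth x0 e i)) //= leq_maxl.
have -> : (\sum_(1 <= t < size e) (par t == i) =
    #|[set t : 'I_(size e) | (0 < t)%N && (par t == i)]|)%N.
  rewrite -sum1_card [RHS]big_mkcond /=.
  have [se0|se0] := posnP (size e); first by rewrite se0 in ie.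
  under [RHS]eq_bigr => t _ do rewrite inE.
  rewrite -(big_mkord predT (fun t => if (0 < t)%N && (par t == i) then 1%N else 0%N)).
  rewrite [RHS]big_ltn //= add0n; apply: eq_big_nat => t /andP[-> _] /=.
  by case: (par t == i).
have inj : {in [set t : 'I_(size e) | (0 < t)%N && (par t == i)] &,
    injective (fun t : 'I_(size e) => nth x0 e t)}.
  by move=> t t' _ _ /eqP; rewrite nth_uniq // => /eqP/val_inj.
rewrite -(card_in_imset inj); apply: subset_leq_card; apply/subsetP => y.
move=> /imsetP[t]; rewrite inE => /andP[t0 /eqP pti] ->.
by rewrite inE -pti par_adj // t0 ltn_ord.
Qed.

End TreeCodes.

(** * From packable lists of codes to edge-disjoint subgraphs *)

Section PackingFromEmbeddings.

(** Each tree avoids the edges of all earlier ones; unrolling the recursion turns this into pairwise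
    disjointness. *)
Lemma packable_family (V : finType) (v0 : V) (I : eqType) (c : I -> code)
    (r : seq I) (F E : {set {set V}}) : uniq r ->
  packable v0 [seq c i | i <- r] F E ->
  exists S : I -> seq V,
    (forall i, i \in r -> [/\ uniq (S i), size (S i) = (c i).1 &
       tree_edges v0 (c i).2 (S i) \subset E :\: F]) /\
    {in r &, forall i j, i != j -> forall e,
       ~~ ((e \in tree_edges v0 (c i).2 (S i)) && (e \in tree_edges v0 (c j).2 (S j)))}.
Proof.
elim: r F => [|i r IHr] F /=; first by move=> _ _; exists (fun=> [::]).
move=> /andP[ir ur] [s [us ss Es Ps]].
have [S [S1 S2]] := IHr _ ur Ps.
exists (fun j => if j == i then s else S j); split.
  move=> j; rewrite inE; have [-> _|ji /= jr] := eqVneq j i.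
    split=> //; apply/subsetP => e; rewrite inE => /existsP[t /andP[t0 /eqP ->]].
    by apply: Es; rewrite t0 -ss ltn_ord.
  have [? ? Sj] := S1 j jr; split=> //; apply/subsetP => e /(subsetP Sj).
  by rewrite !inE negb_or => /andP[/andP[-> _] ->].
have off j e : j \in r -> e \in tree_edges v0 (c j).2 (S j) ->
    e \notin tree_edges v0 (c i).2 s.
  move=> jr; have [_ _ Sj] := S1 j jr.
  by move=> /(subsetP Sj); rewrite in_setD in_setU negb_or => /andP[/andP[_ ->]].
move=> j k; rewrite !inE; have [->|ji] := eqVneq j i; have [->|ki] := eqVneq k i => //=.
- by move=> _ kr _ e; apply/negP => /andP[e1 e2]; have := off k e kr e2; rewrite e1.
- by move=> jr _ _ e; apply/negP => /andP[e1 e2]; have := off j e jr e1; rewrite e2.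
- by move=> jr kr jk; exact: S2.
Qed.

Section OneTree.
Variables (n : nat) (v0 : 'I_n) (G : graph) (x0 : G) (g : seq G) (par : nat -> nat).
Variables (s : seq 'I_n) (E : {set {set 'I_n}}).
Hypothesis g_coded : coded x0 g par.
Hypothesis g_all : forall x : G, x \in g.
Hypothesis s_uniq : uniq s.
Hypothesis s_size : size s = size g.
Hypothesis s_edges : tree_edges v0 par s \subset E.

Let image_adj : rel (graph_of_edges E) :=
  fun x y => (x != y) && ([set x; y] \in tree_edges v0 par s).

Fact image_adj_sym : symmetric image_adj.
Proof. by move=> x y; rewrite /image_adj eq_sym setUC. Qed.

Let par_lt t : (0 < t < size s)%N -> (par t < t)%N.
Proof. by rewrite s_size; case: g_coded => _ + _ _; apply. Qed.

Fact image_adj_vertex x y : image_adj x y -> x \in [set z in s].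
Proof.
move=> /andP[_]; rewrite inE => /existsP[t /andP[t0 /eqP xyE]].
have ts := ltn_ord t; have pt : (par t < t)%N by apply: par_lt; rewrite t0.
have : x \in edge_at v0 par s t by rewrite -xyE !inE eqxx.
by rewrite !inE => /orP[]/eqP ->; rewrite mem_nth // (ltn_trans pt).
Qed.

Fact image_adj_adj x y : image_adj x y -> @adj (graph_of_edges E) x y.
Proof. by move=> /andP[xy /(subsetP s_edges) xyE]; rewrite /= xy. Qed.

Definition image_tree : subgraph (graph_of_edges E) :=
  Subgraph image_adj_sym image_adj_vertex image_adj_adj.

Lemma image_tree_isomorphic : isomorphic (graph_of_subgraph image_tree) G.
Proof.
have [ug _ gadj gcov] := g_coded.
have mem_s (x : {x : 'I_n | x \in [set z in s]}) : val x \in s.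
  by have := valP x; rewrite inE.
pose f (x : {x : 'I_n | x \in [set z in s]}) : G := nth x0 g (index (val x) s).
have idx (x : {x : 'I_n | x \in [set z in s]}) : 
    (index (val x) s < size g)%N by rewrite -s_size index_mem mem_s.
have f_inj : injective f.
  move=> x y /eqP; rewrite nth_uniq // => /eqP xy.
  apply: val_inj; have := nth_index v0 (mem_s x); rewrite xy => <-.
  exact: nth_index (mem_s y).
exists f.
  apply: inj_card_bij => //.
  rewrite card_sig (_ : #|G| = size g); last first.
    by rewrite -(card_uniqP ug); apply: eq_card => x; rewrite g_all.
  rewrite -s_size -(card_uniqP s_uniq).
  by apply: subset_leq_card; apply/subsetP => x; rewrite !inE.
have edgeE x y : @adj (graph_of_subgraph image_tree) x y =
    (val x != val y) && ([set val x; val y] \in tree_edges v0 par s) by [].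
move=> x y; rewrite edgeE; apply/idP/andP => [fxy|[xy]].
  split.
    by apply: contraTneq fxy => /val_inj ->; rewrite adj_irr.
  have [t /andP[t0 tg] fE] := gcov _ _ (g_all _) (g_all _) fxy.
  have ts : (t < size s)%N by rewrite s_size.
  have pt : (par t < t)%N by apply: par_lt; rewrite t0.
  rewrite inE; apply/existsP; exists (Ordinal ts); rewrite /= t0 /=.
  (* The inverse of [f], which carries the equality of edges in [G] back to the host vertices. *)
  pose back (z : G) := nth v0 s (index z g).
  have backf z : back (f z) = val z.
    by rewrite /back /f index_uniq ?idx // nth_index //; exact: mem_s.
  have := congr1 (fun A : {set G} => back @: A) fE; rewrite !imsetU1 !imset_set1 !backf.
  rewrite /back !index_uniq ?(ltn_trans pt) // => xyE.
  by apply/eqP; rewrite xyE.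
rewrite inE => /existsP[t /andP[t0 /eqP xyE]].
have ts := ltn_ord t; have tg : (t < size g)%N by rewrite -s_size.
have pt : (par t < t)%N by apply: par_lt; rewrite t0.
have ad := gadj t; rewrite t0 tg in ad.
have fwd z i : (i < size s)%N -> val z = nth v0 s i -> f z = nth x0 g i.
  by move=> si zi; rewrite /f zi index_uniq.
have xE : val x \in edge_at v0 par s t by rewrite -xyE !inE eqxx.
have yE : val y \in edge_at v0 par s t by rewrite -xyE !inE eqxx orbT.
have ps := ltn_trans pt ts.
move: xE yE; rewrite !inE => /orP[]/eqP xt /orP[]/eqP yt.
- by rewrite xt yt eqxx in xy.
- by rewrite (fwd _ _ ts xt) (fwd _ _ ps yt) adj_sym ad.
- by rewrite (fwd _ _ ps xt) (fwd _ _ ts yt) ad.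
- by rewrite xt yt eqxx in xy.
Qed.

End OneTree.

Lemma packs_of_packable (n t : nat) (v0 : 'I_n) (F : 'I_t -> graph) (c : 'I_t -> code)
    (E : {set {set 'I_n}}) :
  (forall i, exists x0 g, [/\ coded x0 g (c i).2, size g = (c i).1 &
     forall x : F i, x \in g]) ->
  packable v0 [seq c i | i <- enum 'I_t] set0 E -> packs F (graph_of_edges E).
Proof.
move=> cF /packable_family[|S [S1 S2]]; first exact: enum_uniq.
have sub i : tree_edges v0 (c i).2 (S i) \subset E.
  by have [_ _] := S1 i (mem_enum _ i); rewrite setD0.
have H i : exists Hi : subgraph (graph_of_edges E),
   isomorphic (graph_of_subgraph Hi) (F i) /\
   forall x y, sub_adj Hi x y -> [set x; y] \in tree_edges v0 (c i).2 (S i).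
  have [x0 [g [gc gs gall]]] := cF i.
  have [us ss _] := S1 i (mem_enum _ i).
  have ssg : size (S i) = size g by rewrite ss gs.
  exists (image_tree gc ssg (sub i)); split.
    exact: image_tree_isomorphic.
  by move=> x y /andP[].
have [Hf HfP] := choice H.
exists Hf; split=> [i|i j ij x y]; first by have [] := HfP i.
apply/negP => /andP[xi xj].
have [_ /(_ _ _ xi) ei] := HfP i; have [_ /(_ _ _ xj) ej] := HfP j.
have := S2 i j (mem_enum _ i) (mem_enum _ j) ij [set x; y].
by rewrite ei ej.
Qed.

End PackingFromEmbeddings.

(** * Choice of the constants *)

Section Constants.
Variable R : realType.
Implicit Types eps x : R.

Lemma inv1B_le_expR x : 0 <= x <= 1 / 2 -> (1 - x)^-1 <= expR (2 * x).
Proof.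
move=> /andP[x0 x1]; apply: le_trans (expR_ge1Dx _).
rewrite -div1r ler_pdivrMr; nra.
Qed.

(** Each correction factor in [kappa] is at most the exponential of a small multiple of [eps]. The
    exponents add up to less than [eps], so the factor $1-\varepsilon$ from the size of the trees
    absorbs them all, by $(1-\varepsilon)e^\varepsilon\le1$. *)
Lemma kappa_le eps (nn lam theta mu : R) : 0 < eps < 1 -> 64 / eps <= nn -> 0 <= lam ->
  theta = lam / (1 - eps / 64) -> theta <= eps ^+ 2 / 32 * nn -> 0 <= mu ->
  mu <= (1 - eps) * nn ->
  kappa (eps ^+ 3 / 256 * nn) (eps / 2 * nn) theta (eps / 8) mu ((1 - eps / 32) * nn) <=
  2 * lam / nn.
Proof.
move=> /andP[e0 e1] nn_ge lam0 thetaE theta_le mu0 mu_le.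
have nn0 : 0 < nn by apply: lt_le_trans nn_ge; rewrite divr_gt0.
have enn : 64 <= eps * nn by rewrite mulrC -ler_pdivrMr.
have theta0 : 0 <= theta by rewrite thetaE divr_ge0 //; lra.
have D1 : 1 + eps ^+ 3 / 256 * nn / (eps / 2 * nn) <= expR (eps / 128).
  rewrite (_ : _ / _ = eps ^+ 2 / 128); last by field; rewrite !gt_eqF.
  apply: le_trans (expR_ge1Dx _); nra.
have D2 : expR (2 * (2 / (eps / 2 * nn)) * (2 * (eps ^+ 3 / 256 * nn) / (eps / 2 * nn)) * mu)
    <= expR (eps / 8).
  rewrite ler_expR (_ : _ * mu = (eps / 8) * (mu / nn)); last by field; rewrite !gt_eqF.
  rewrite -[X in _ <= X]mulr1 ler_wpM2l ?divr_ge0 ?(ltW e0) //.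
  by rewrite ler_pdivrMr // mul1r (le_trans mu_le) //; nra.
have D3 : 1 + (eps ^+ 3 / 256 * nn + theta) / (eps / 2 * nn) <= expR (eps / 128 + eps / 16).
  apply: le_trans (expR_ge1Dx _); rewrite lerD2l ler_pdivrMr; last by nra.
  have : eps ^+ 3 / 256 * nn <= eps / 128 * (eps / 2 * nn).
    rewrite (_ : eps ^+ 3 / 256 * nn = eps / 128 * (eps / 2 * nn) * eps); last by field.
    by rewrite ler_piMr ?(ltW e1) // !mulr_ge0 ?invr_ge0 // ltW.
  nra.
have D4 : theta <= lam * expR (eps / 32).
  rewrite thetaE; apply: ler_wpM2l => //.
  rewrite (_ : eps / 32 = 2 * (eps / 64)); last by field.
  by apply: inv1B_le_expR; apply/andP; split; lra.
have D5 : (((1 - eps / 32) * nn) * ((1 - eps / 32) * nn - 1))^-1 <=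
    expR (eps / 4) / nn ^+ 2.
  have h : ((1 - eps / 16) * nn) ^+ 2 <= ((1 - eps / 32) * nn) * ((1 - eps / 32) * nn - 1).
    by rewrite expr2; apply: ler_pM; nra.
  have h0 : 0 < (1 - eps / 16) * nn by rewrite mulr_gt0 //; lra.
  apply: le_trans (_ : (((1 - eps / 16) * nn) ^+ 2)^-1 <= _).
    by rewrite lef_pV2 ?posrE ?exprn_gt0 // (lt_le_trans _ h) // exprn_gt0.
  rewrite exprMn invfM; apply: ler_wpM2r; first by rewrite invr_ge0 exprn_ge0 // ltW.
  rewrite (_ : eps / 4 = 2 * (2 * (eps / 16))); last by field.
  rewrite expRM_natl -exprVn lerXn2r ?nnegrE ?expR_ge0 ?invr_ge0 //; first by lra.
  by apply: inv1B_le_expR; apply/andP; split; lra.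
have D6 : 1 + eps / 8 <= expR (eps / 8) by exact: expR_ge1Dx.
have D7 : (1 - eps) * expR eps <= 1.
  have := expR_ge1Dx (- eps); rewrite expRN => h.
  by rewrite -ler_pdivlMr ?expR_gt0 // div1r.
rewrite /kappa.
set x1 := 1 + _ / _ in D1 *; set x2 := expR (_ * mu) in D2 *.
set x3 := 1 + (_ + theta) / _ in D3 *.
set x5 := (_ * (_ - 1)) in D5 *.
have dn0 : 0 <= eps ^+ 3 / 256 * nn.
  exact: mulr_ge0 (divr_ge0 (exprn_ge0 3 (ltW e0)) (ler0n _ _)) (ltW nn0).
have A00 : 0 <= eps / 2 * nn.
  exact: mulr_ge0 (divr_ge0 (ltW e0) (ler0n _ _)) (ltW nn0).
have x10 : 0 <= x1 :=  (addr_ge0 ler01 (divr_ge0 dn0 A00)).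
have x30 : 0 <= x3 :=  (addr_ge0 ler01 (divr_ge0 (addr_ge0 dn0 theta0) A00)).
have x50 : 0 <= x5^-1.
  by rewrite invr_ge0; apply: mulr_ge0; nra.
have x20 : 0 <= x2 by exact: expR_ge0.
apply: le_trans (_ : expR (eps / 8) * (2 * expR (eps / 128) * expR (eps / 8) *
   (expR (eps / 4) / nn ^+ 2) *
   ((1 - eps) * nn * (lam * expR (eps / 32)) * expR (eps / 128 + eps / 16))) <= _).
  by repeat (apply: ler_pM; rewrite ?mulr_ge0 ?expR_ge0 //; try lra).
rewrite (_ : _ * _ = (2 * lam / nn) * ((1 - eps) * (expR (eps / 8) * expR (eps / 128) *
  expR (eps / 8) * expR (eps / 4) * expR (eps / 32) * expR (eps / 128 + eps / 16)))); last first.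
  by field; rewrite gt_eqF.
rewrite -[X in _ <= X]mulr1; apply: ler_wpM2l.
  by rewrite divr_ge0 ?mulr_ge0 // ltW.
rewrite -!expRD; apply: le_trans D7; apply: ler_wpM2l; first by lra.
by rewrite ler_expR; lra.
Qed.

End Constants.

(** * One colour class, of small edge probability *)

Section FiniteBound.
Variable R : realType.

Lemma card_pairs_le (V : finType) : (#|pairs V| <= #|V| ^ 2)%N.
Proof.
have sub : pairs V \subset [set [set u.1; u.2] | u : V * V].
  apply/subsetP => e /pairsP[a [b [_ ->]]].
  by apply/imsetP; exists (a, b).
apply: leq_trans (subset_leq_card sub) _.
by apply: leq_trans (leq_imset_card _ _) _; rewrite card_prod mulnn.
Qed.

(** Each of at most $(1-3\varepsilon/4)np'/2$ trees adds at most $2\lambda/n$ to the exponent at a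
    pair, which starts at $-\lambda p'$ and so ends at most at $-\frac34\varepsilon\lambda
    p'=-\frac92\log n$. Bounding each term by $n^{-3}$ over at most $n^2$ pairs, with $C\le2$, gives
    $2/n$. *)
Lemma Pr_packable_group (eps p' : R) (n N' : nat) (v0 : 'I_n) (l : seq code) :
  0 < eps < 1 -> 64 / eps <= n%:R -> 1 <= ln (n%:R : R) -> 0 < p' ->
  p' <= eps ^+ 4 / 2 ^+ 13 -> ln n%:R <= eps ^+ 3 / 384 * (n%:R * p') ->
  N'%:R <= (1 - 3 * eps / 4) * (n%:R * p') / 2 -> (size l <= N')%N ->
  List.Forall (code_ok (eps ^+ 4 / 2 ^+ 10 * (n%:R * p' / ln n%:R) + 1)
    ((1 - eps) * n%:R)) l ->
  1 - 2 / n%:R <= Pr (edge_prob p') (packable v0 l set0).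
Proof.
move=> e01 nn_ge L1 p0 p_le L_le N'_le lN' l_ok.
have /andP[e0 e1] := e01.
have n0 : (0 < n)%N by apply: leq_trans (ltn_ord v0).
set nn := n%:R in nn_ge L1 L_le N'_le l_ok *; set L := ln nn in L1 L_le l_ok *.
have nn0 : 0 < nn by rewrite ltr0n.
have L0 : 0 < L by apply: lt_le_trans L1.
have enn : 64 <= eps * nn by rewrite mulrC -ler_pdivrMr.
(* [lam] turns the slack $3\varepsilon/4$ in the number of trees into $\frac92\log n$. Then [q]
   gives $\lambda q=x$ with $x=\varepsilon/64$, and [theta] gives $\theta q=x/(1-x)\ge e^x-1$. *)
pose lam := 6 * L / (eps * p').
pose theta := lam / (1 - eps / 64).
pose q := eps / 64 / lam.
have ep0 : 0 < eps * p' by rewrite mulr_gt0.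
have e3 : eps ^+ 3 <= 1 by rewrite exprn_ile1 // ltW.
have e4 : eps ^+ 4 <= 1 by rewrite exprn_ile1 // ltW.
have p1 : p' <= 1 by apply: le_trans p_le _; lra.
have lam1 : 1 <= lam by rewrite /lam ler_pdivlMr // mul1r; nra.
have lam0 : 0 < lam by apply: lt_le_trans lam1.
have lamq : lam * q = eps / 64 by rewrite /q mulrC divfK ?gt_eqF.
have theta0 : 0 <= theta by rewrite divr_ge0 ?(ltW lam0) //; lra.
have theta_lam : theta <= 2 * lam.
  by rewrite /theta ler_pdivrMr; [nra|lra].
have theta_le : theta <= eps ^+ 2 / 32 * nn.
  apply: le_trans theta_lam _.
  rewrite (_ : 2 * lam = 12 * L / (eps * p')); last by rewrite /lam; field; rewrite !gt_eqF.
  rewrite ler_pdivrMr //.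
  by rewrite [X in _ <= X](_ : _ = 12 * (eps ^+ 3 / 384 * (nn * p'))); [lra|field].
have q01 : 0 < q <= 1.
  apply/andP; split; first by rewrite divr_gt0 // divr_gt0.
  by rewrite /q ler_pdivrMr // mul1r (le_trans _ lam1) //; lra.
have C1 : 1 <= expR (eps / 64) * expR (- (lam * q)).
  by rewrite lamq -expRD subrr expR0.
have thetaq : (1 - q) * (expR (lam * q) - 1) <= theta * q.
  have -> : theta * q = eps / 64 / (1 - eps / 64).
    by rewrite -[X in _ = X / _]lamq /theta mulrAC.
  have e64 : 0 < 1 - eps / 64 by lra.
  apply: le_trans (_ : expR (lam * q) - 1 <= _).
    rewrite ler_piMl //; last by case/andP: q01 => q0 _; lra.
    by rewrite subr_ge0 -[X in X <= _]expR0 ler_expR lamq; lra.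
  rewrite lamq lerBlDr [X in _ <= X](_ : _ = (1 - eps / 64)^-1); last first.
    rewrite -[X in _ + X](divff (lt0r_neq0 e64)) -mulrDl [_ + (1 - _)]addrC subrK.
    exact: div1r.
  rewrite -(invrK (expR _)) lef_pV2 ?posrE ?invr_gt0 ?expR_gt0 //.
  by rewrite -expRN; have := expR_ge1Dx (- (eps / 64)).
(* A tree leaves at least $\varepsilon n$ vertices free; [A0] reserves half of them, and the other
   half covers vertices of high used degree, used edges at the parent, and [theta]. *)
pose dn := eps ^+ 3 / 256 * nn; pose A0 := eps / 2 * nn.
pose mu := (1 - eps) * nn; pose w0 := (1 - eps / 32) * nn.
have mu0 : 0 <= mu by rewrite mulr_ge0 ?(ltW nn0) // subr_ge0 ltW.
have A00 : 0 < A0 by rewrite mulr_gt0 // divr_gt0.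
have dn0 : 0 < dn := mulr_gt0 (divr_gt0 (exprn_gt0 3 e0) (ltr0Sn _ _)) nn0.
have e2e : eps ^+ 2 <= eps by rewrite expr2; nra.
have e3e : eps ^+ 3 <= eps by rewrite exprS; nra.
have A0_le : A0 + 2 <= w0 - mu - dn - theta.
  have h1 : dn <= eps / 256 * nn.
    by apply: (ler_wpM2r (ltW nn0)); apply: (ler_wpM2r _ e3e); lra.
  have h2 : theta <= eps / 32 * nn.
    by apply: le_trans theta_le _; rewrite ler_wpM2r ?ler_wpM2r ?invr_ge0 ?(ltW nn0).
  by rewrite /A0 /w0 /mu; lra.
set Delta := eps ^+ 4 / 2 ^+ 10 * (nn * p' / L) + 1 in l_ok.
have np0 : 0 < nn * p' by rewrite mulr_gt0.
have Delta_A0 : 4 * Delta <= A0.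
  have h1 : nn * p' / L <= nn.
    by rewrite ler_pdivrMr //; apply: ler_pM; rewrite ?(ltW nn0) ?(ltW p0) //; lra.
  have h2 : eps ^+ 4 / 2 ^+ 10 * (nn * p' / L) <= eps / 2 ^+ 10 * nn.
    apply: ler_pM => //.
    - by rewrite divr_ge0 // exprn_ge0 // ltW.
    - by rewrite divr_ge0 // ltW.
    rewrite ler_wpM2r ?invr_ge0 // (exprS eps 3).
    by rewrite ler_piMr // ltW.
  by rewrite /Delta /A0; lra.
(* The degree bound of order $np/\log n$ enters here: [theta] has order $\log n/(\varepsilon p')$,
   which makes [Delta * theta] a small multiple of $\varepsilon^2n$. *)
have Delta_theta : (1 + eps / 8) * (Delta * theta) <= eps / 8 * A0.
  have h : eps ^+ 4 / 2 ^+ 10 * (nn * p' / L) * theta <= 12 / 2 ^+ 10 * eps ^+ 2 * nn.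
    apply: le_trans (_ : eps ^+ 4 / 2 ^+ 10 * (nn * p' / L) * (2 * lam) <= _).
      apply: ler_wpM2l theta_lam.
      by rewrite mulr_ge0 // divr_ge0 ?exprn_ge0 // ltW.
    rewrite [X in X <= _](_ : _ = 12 / 2 ^+ 10 * (eps ^+ 2 * eps) * nn); last first.
      by rewrite /lam; field; rewrite !gt_eqF.
    apply: ler_wpM2r; first exact: ltW.
    by rewrite ler_wpM2l ?ler_piMr ?exprn_ge0 ?(ltW e0) ?(ltW e1).
  have h2 : Delta * theta <= (12 / 2 ^+ 10 + 1 / 32) * (eps ^+ 2 * nn).
    by rewrite /Delta mulrDl mul1r; lra.
  have h3 : 0 <= eps ^+ 2 * nn by rewrite mulr_ge0 ?exprn_ge0 // ltW.
  apply: le_trans (_ : (1 + eps / 8) * ((12 / 2 ^+ 10 + 1 / 32) * (eps ^+ 2 * nn)) <= _).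
    by rewrite ler_wpM2l //; lra.
  rewrite [X in _ <= X](_ : _ = 1 / 16 * (eps ^+ 2 * nn)); last by rewrite /A0; field.
  by rewrite mulrA; apply: ler_wpM2r => //; lra.
(* Fewer than $np'/2$ trees of at most $n$ edges each. For $p'\le\varepsilon^4/2^{13}$ at most
   $\varepsilon n/32$ vertices then exceed the used degree [dn], as [w0] presumes. *)
pose fmax := nn * (nn * p') / 2.
have w0_le : w0 <= #|'I_n|%:R - 2 * fmax / dn.
  rewrite card_ord -/nn /w0 mulrBl mul1r lerD2l lerN2 /fmax.
  rewrite ler_pdivrMr // /dn.
  rewrite [X in X <= _](_ : _ = nn * nn * p'); last by field.
  rewrite [X in _ <= X](_ : _ = nn * nn * (eps ^+ 4 / 2 ^+ 13)); last by field.
  by apply: ler_wpM2l => //; rewrite mulr_ge0 // ltW.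
have sizeN' : (size l)%:R <= N'%:R :> R by rewrite ler_nat.
have r01 : prob_vector (edge_prob p' : {set 'I_n} -> R).
  by move=> e; rewrite /edge_prob; case: ifP => _; rewrite ?lexx ?ler01 // (ltW p0).
have Fl : #|set0 : {set {set 'I_n}}|%:R + (size l)%:R * mu <= fmax.
  rewrite cards0 add0r /fmax.
  apply: le_trans (_ : (nn * p' / 2) * nn <= _); last first.
    by rewrite (_ : _ * nn = nn * (nn * p') / 2) ?lexx //; field.
  apply: ler_pM => //.
    by apply: le_trans sizeN' (le_trans N'_le _); nra.
  by rewrite /mu; nra.
have eta0 : 0 <= eps / 8 := divr_ge0 (ltW e0) (ler0n _ _).
have := Pr_packable v0 A00 (ltW dn0) theta0 eta0 A0_le
  Delta_A0 Delta_theta q01 (ltW lam0) C1 thetaq dn0 w0_le (sub0set _) l_ok Fl r01.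
apply: le_trans; rewrite lerD2l lerN2.
set k := kappa _ _ _ _ _ _.
have k_le : k <= 2 * lam / nn.
  by apply: kappa_le => //; exact: ltW.
rewrite /potential.
have exp_le e : e \in pairs 'I_n ->
    expR (- (lam * edge_prob p' e)) * expR (k * (size l)%:R) <= (nn ^+ 3)^-1.
  move=> ep; rewrite -expRD /edge_prob -[possible_edges n]/(pairs 'I_n) ep.
  rewrite -[nn]lnK ?posrE // -/L -expRM_natl -expRN ler_expR.
  have h1 : k * (size l)%:R <= 2 * lam / nn * ((1 - 3 * eps / 4) * (nn * p') / 2).
    apply: le_trans (_ : 2 * lam / nn * (size l)%:R <= _).
      by apply: ler_wpM2r.
    apply: ler_wpM2l.
      exact: divr_ge0 (mulr_ge0 (ler0n _ _) (ltW lam0)) (ltW nn0).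
    exact: le_trans sizeN' N'_le.
  have h2 : 2 * lam / nn * ((1 - 3 * eps / 4) * (nn * p') / 2) =
      lam * p' - lam * (3 * eps / 4 * p') by field; rewrite gt_eqF.
  have h3 : lam * (3 * eps / 4 * p') = 9 / 2 * L.
    by rewrite /lam; field; rewrite !gt_eqF.
  by lra.
have pairs_le : #|pairs 'I_n|%:R <= nn ^+ 2.
  by rewrite -natrX ler_nat; apply: leq_trans (card_pairs_le _) _; rewrite card_ord.
have C2 : expR (eps / 64) <= 2.
  have := @expR_sub1_le R (eps / 64); have -> : 0 <= eps / 64 <= 1 / 2 by lra.
  by move=> /(_ isT); lra.
apply: le_trans (_ : 2 * (nn ^+ 2 * (nn ^+ 3)^-1) <= _); last first.
  by rewrite (_ : nn ^+ 2 * _ = nn^-1) //; field; rewrite gt_eqF.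
apply: ler_pM; [exact: expR_ge0| |exact: C2|].
  by apply: sumr_ge0 => e _; rewrite mulr_ge0 ?expR_ge0.
apply: le_trans (ler_sum _ exp_le) _.
rewrite sumr_const -mulr_natl; apply: ler_wpM2r => //.
by rewrite invr_ge0 exprn_ge0 // ltW.
Qed.

End FiniteBound.

(** * Packing in the binomial random graph *)

Lemma tree_code_ok (R : realType) (G : graph) (Delta mu : R) : is_tree G ->
  (max_degree G)%:R + 1 <= Delta -> #|G|%:R <= mu ->
  exists c : code, code_ok Delta mu c /\ exists x0 g,
    [/\ coded x0 g c.2, size g = c.1 & forall x : G, x \in g].
Proof.
move=> Gtree degG cardG.
have [x0 [g [par [gc sg gall]]]] := tree_code Gtree.
exists (size g, par); split; last by exists x0, g.
have g0 : (0 < size g)%N by rewrite sg; case: Gtree => -[].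
have [_ par_lt _ _] := gc.
split=> //=; first by rewrite sg.
(* The meaningless term [t = 0] contributes at most 1; the others count children. *)
move=> i; rewrite big_ltn // addrC; apply: le_trans degG; apply: lerD.
  by rewrite -natr_sum ler_nat; exact: coded_degree gc.
by rewrite lern1 leq_b1.
Qed.

(** [K] is the number of colours. Its lower bound gives $p/K\le\varepsilon^4/2^{13}$; its upper
    bound gives $(\varepsilon/8)^8K\le\varepsilon^4/2^{10}$, the degree constant for one colour
    class. *)
Lemma gnp_packs_ge (R : realType) (eps p : R) (K n N : nat) (T : 'I_N -> graph) :
  0 < eps < 1 -> 2 ^+ 13 / eps ^+ 4 <= K%:R -> K%:R <= 2 ^+ 14 / eps ^+ 4 ->
  64 / eps <= n%:R -> 1 <= ln (n%:R : R) -> 0 < p <= 1 ->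
  ln n%:R <= eps ^+ 3 / 384 * (n%:R * (p / K%:R)) -> 8 <= eps * (n%:R * (p / K%:R)) ->
  N%:R <= (1 - eps) * n%:R * p / 2 ->
  (forall i, is_tree (T i)) -> (forall i, #|T i|%:R <= (1 - eps) * n%:R) ->
  (forall i, (max_degree (T i))%:R <= (eps / 8) ^+ 8 * (n%:R * p / ln n%:R)) ->
  1 - K%:R * (2 / n%:R) <= gnp_prob n p (packs T).
Proof.
move=> e01 K_ge K_le nn_ge L1 /andP[p0 p1] L_le e8 N_le Ttree Tcard Tdeg.
have /andP[e0 e1] := e01.
have e40 : 0 < eps ^+ 4 by exact: exprn_gt0.
have K0 : 0 < K%:R :> R by apply: lt_le_trans K_ge; rewrite divr_gt0 ?exprn_gt0.
have K0n : (0 < K)%N by rewrite -(ltr0n R).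
have nn0 : 0 < n%:R :> R by apply: lt_le_trans nn_ge; rewrite divr_gt0.
have n0 : (0 < n)%N by rewrite -(ltr0n R).
have L0 : 0 < ln (n%:R : R) by apply: lt_le_trans L1.
pose v0 : 'I_n := Ordinal n0.
set p' := p / K%:R in L_le e8.
have p'0 : 0 < p' by exact: divr_gt0.
have pE : p = K%:R * p' by rewrite /p' mulrC divfK // gt_eqF.
pose Delta := eps ^+ 4 / 2 ^+ 10 * (n%:R * p' / ln n%:R) + 1.
pose mu := (1 - eps) * n%:R : R.
have code_T i : exists c : code, code_ok Delta mu c /\ exists x0 g,
    [/\ coded x0 g c.2, size g = c.1 & forall x : T i, x \in g].
  apply: (tree_code_ok (Ttree i) _ (Tcard i)).
  rewrite lerD2r; apply: le_trans (Tdeg i) _.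
  rewrite pE (_ : n%:R * (K%:R * p') / ln n%:R = K%:R * (n%:R * p' / ln n%:R)); last first.
    by field; rewrite gt_eqF.
  rewrite mulrA; apply: ler_wpM2r.
    exact: divr_ge0 (mulr_ge0 (ltW nn0) (ltW p'0)) (ltW L0).
  apply: le_trans (ler_wpM2l _ K_le) _; first by rewrite exprn_ge0 // divr_ge0 // ltW.
  by rewrite le_eqVlt; apply/orP; left; apply/eqP; field; rewrite gt_eqF.
have [c cP] := choice code_T.
have l_ok : List.Forall (code_ok Delta mu) [seq c i | i <- enum 'I_N].
  elim: (enum 'I_N) => [|i r IHr] /=; first exact: List.Forall_nil.
  by apply: List.Forall_cons IHr; case: (cP i).
(* Rounding up costs one tree per class; as $\varepsilon np'\ge8$, it fits between $1-\varepsilon$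
   and $1-3\varepsilon/4$. *)
have N'_le : (N %/ K).+1%:R <= (1 - 3 * eps / 4) * (n%:R * p') / 2.
  rewrite -natr1; apply: le_trans (_ : N%:R / K%:R + 1 <= _).
    by rewrite lerD2r ler_pdivlMr // -natrM ler_nat leq_trunc_div.
  have : N%:R / K%:R <= (1 - eps) * (n%:R * p') / 2.
    rewrite ler_pdivrMr //; apply: le_trans N_le _.
    by rewrite pE le_eqVlt; apply/orP; left; apply/eqP; field.
  by lra.
have p'_le : p' <= eps ^+ 4 / 2 ^+ 13.
  rewrite /p' ler_pdivrMr //; apply: le_trans p1 _.
  have := ler_wpM2l (ltW (divr_gt0 e40 (exprn_gt0 13 (ltr0Sn R 1)))) K_ge.
  by apply: le_trans; rewrite le_eqVlt; apply/orP; left; apply/eqP; field; rewrite gt_eqF.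
rewrite gnp_probE.
have -> : edge_prob p = (fun e => K%:R * edge_prob p' e) :> ({set 'I_n} -> R).
  by apply/funext => e; rewrite /edge_prob; case: ifP; rewrite -?pE ?mulr0.
have r0 (e : {set 'I_n}) : 0 <= edge_prob p' e.
  by rewrite /edge_prob; case: ifP => // _; exact: ltW.
have r1 (e : {set 'I_n}) : K%:R * edge_prob p' e <= 1.
  by rewrite /edge_prob; case: ifP => _; rewrite -?pE // mulr0.
apply: le_trans (_ : _ <= Pr (fun e => K%:R * edge_prob p' e)
   (packable v0 [seq c i | i <- enum 'I_N] set0)) _.
  apply: (Pr_packable_groups (N := (N %/ K).+1) r0 r1 _ l_ok).
    move=> l' l'_ok l'N.
    exact: (Pr_packable_group v0 e01 nn_ge L1 p'0 p'_le L_le N'_le l'N l'_ok).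
  by rewrite size_map size_enum_ord mulnC ltnW // ltn_ceil.
apply: le_Pr => [e|E]; first by rewrite r1 andbT mulr_ge0.
by apply: packs_of_packable => i; case: (cP i).
Qed.

Lemma gnp_prob_le1 (R : realType) (n : nat) (p : R) (A : graph -> Prop) :
  0 <= p <= 1 -> gnp_prob n p A <= 1.
Proof.
move=> p01; rewrite gnp_probE -(Pr_true (edge_prob p : {set 'I_n} -> R)).
by apply: le_Pr => // e; rewrite /edge_prob; case: ifP => // _; rewrite lexx ler01.
Qed.

Local Open Scope classical_set_scope.
Local Open Scope ring_scope.

Lemma gnp_packs_cvg (R : realType) (eps : R) (p : nat -> R) (N : nat -> nat)
    (T : forall n : nat, 'I_(N n) -> graph) :
  0 < eps < 1 -> (forall n, 0 <= p n <= 1) ->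
  p n * n%:R / (ln n%:R) ^+ 2 @[n --> \oo] --> +oo ->
  (forall n, (N n)%:R <= (1 - eps) * n%:R * p n / 2) ->
  (forall n (i : 'I_(N n)), is_tree (T n i)) ->
  (forall n (i : 'I_(N n)), #|T n i|%:R <= (1 - eps) * n%:R) ->
  (forall n (i : 'I_(N n)),
     (max_degree (T n i))%:R <= (eps / 8) ^+ 8 * (n%:R * p n / ln n%:R)) ->
  gnp_prob n (p n) (packs (T n)) @[n --> \oo] --> (1 : R).
Proof.
move=> e01 p01 plim N_le Ttree Tcard Tdeg.
have /andP[e0 e1] := e01.
have [K [K_ge K_le]] : exists K : nat,
    2 ^+ 13 / eps ^+ 4 <= K%:R /\ K%:R <= 2 ^+ 14 / eps ^+ 4.
  have x0 : 0 <= 2 ^+ 13 / eps ^+ 4 by rewrite divr_ge0 // exprn_ge0 // ltW.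
  have x1 : 1 <= 2 ^+ 13 / eps ^+ 4.
    rewrite ler_pdivlMr ?exprn_gt0 // mul1r.
    by apply: (@le_trans _ _ 1); [rewrite exprn_ile1 // ltW|rewrite exprn_ege1 // ler1n].
  have /andP[tr1 tr2] := truncn_itv x0.
  (* There is an integer between $x$ and $2x$ because $x\ge1$. *)
  exists (Num.truncn (2 ^+ 13 / eps ^+ 4)).+1; split; first exact: ltW.
  rewrite (exprS 2 13) -mulrA -natr1 mulr_natl mulr2n.
  exact: lerD.
have K0 : 0 < K%:R :> R.
  by apply: lt_le_trans K_ge; rewrite divr_gt0 // exprn_gt0.
(* [harmonic n] is $1/(n+1)$, and $2/n\le4/(n+1)$ for $n\ge1$. *)
apply: (@squeeze_cvgr _ _ _ _ (fun n => 1 - K%:R * 4 * harmonic n) (fun=> 1)); last 1 first.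
- exact: cvg_cst.
- have e3 : 0 < eps ^+ 3 by exact: exprn_gt0.
  near=> n.
  apply/andP; split; last exact: gnp_prob_le1.
  have n1 : 1 <= n%:R :> R by near: n; exact: nbhs_infty_ger.
  have nn0 : 0 < n%:R :> R by exact: lt_le_trans n1.
  have ne : expR 1 <= n%:R :> R by near: n; exact: nbhs_infty_ger.
  have L1 : 1 <= ln (n%:R : R) by rewrite -[X in X <= _]expRK ler_ln ?posrE ?expR_gt0.
  have L0 : 0 < ln (n%:R : R) by exact: lt_le_trans L1.
  (* The two constants are those of the lower bounds on $np/K$ in [gnp_packs_ge]; $(\log n)^2$
     dominates both $\log n$ and 1. *)
  have xM : 384 * K%:R / eps ^+ 3 <= p n * n%:R / (ln n%:R) ^+ 2.
    by near: n; move/cvgryPge : plim; apply.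
  have xM2 : 8 * K%:R / eps <= p n * n%:R / (ln n%:R) ^+ 2.
    by near: n; move/cvgryPge : plim; apply.
  have nM : 64 / eps <= n%:R :> R by near: n; exact: nbhs_infty_ger.
  have L2 : ln n%:R <= (ln n%:R) ^+ 2 :> R by rewrite expr2 ler_peMl // ltW.
  have L21 : 1 <= (ln n%:R) ^+ 2 :> R by exact: le_trans L1 L2.
  have L20 : 0 < (ln n%:R) ^+ 2 :> R by exact: exprn_gt0.
  have p0 : 0 < p n.
    have /andP[p0 _] := p01 n; rewrite lt_neqAle p0 andbT; apply/eqP => pn0.
    move: xM; rewrite -pn0 !mul0r leNgt => /negP; apply.
    exact: divr_gt0 (mulr_gt0 (ltr0Sn _ _) K0) e3.
  have /andP[_ p1] := p01 n.
  apply: le_trans (gnp_packs_ge e01 K_ge K_le nM L1 _ _ _ (N_le n) (Ttree n) (Tcard n) (Tdeg n)).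
  + rewrite lerD2l lerN2 -mulrA ler_pM2l // /harmonic.
    rewrite ler_pdivrMr // mulrAC ler_pdivlMr ?ltr0n // -natr1; lra.
  + by rewrite p0 p1.
  + rewrite ler_pdivlMr // in xM.
    apply: le_trans L2 _.
    rewrite [X in _ <= X](_ : _ = p n * n%:R / (384 * K%:R / eps ^+ 3)); last first.
      by field; rewrite !gt_eqF.
    rewrite ler_pdivlMr; first by rewrite mulrC.
    exact: divr_gt0 (mulr_gt0 (ltr0Sn _ _) K0) e3.
  + rewrite ler_pdivlMr // in xM2.
    rewrite [X in _ <= X](_ : _ = p n * n%:R / (K%:R / eps)); last first.
      by field; rewrite !gt_eqF.
    rewrite ler_pdivlMr ?divr_gt0 // mulrA; apply: le_trans xM2.
    rewrite ler_peMr //; exact: divr_ge0 (mulr_ge0 (ler0n _ _) (ltW K0)) (ltW e0).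
- have : 1 - K%:R * 4 * harmonic n @[n --> \oo] --> (1 - K%:R * 4 * 0 : R).
    apply: cvgB; first exact: cvg_cst.
    by apply: cvgM; [exact: cvg_cst|exact: cvg_harmonic].
  by rewrite mulr0 subr0.
Unshelve. all: by end_near. Qed.

Theorem theorem1p5 (R : realType) (eps : R) (p : nat -> R) (N : nat -> nat)
    (T : forall n : nat, 'I_(N n) -> graph) :
  0 < eps ->
  (forall n, 0 <= p n <= 1) ->
  p n * n%:R / (ln n%:R) ^+ 2 @[n --> \oo] --> +oo ->
  (forall n, (N n)%:R <= (1 - eps) * n%:R * p n / 2) ->
  (forall n (i : 'I_(N n)), is_tree (T n i)) ->
  (forall n (i : 'I_(N n)), #|T n i|%:R <= (1 - eps) * n%:R) ->
  (forall n (i : 'I_(N n)),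
     (max_degree (T n i))%:R <= (eps / 8) ^+ 8 * (n%:R * p n / ln n%:R)) ->
  gnp_prob n (p n) (packs (T n)) @[n --> \oo] --> (1 : R).
Proof.
move=> e0 p01 plim N_le Ttree Tcard Tdeg.
have [e1|e1] := ltP eps 1; first by apply: gnp_packs_cvg (Tdeg); rewrite ?e0.
(* For [1 <= eps] there are no trees, so [eps] may be replaced by [1 / 2]. *)
have N0 n (i : 'I_(N n)) : False.
  have : 0 < (N n)%:R :> R by rewrite ltr0n; apply: leq_ltn_trans (ltn_ord i).
  rewrite ltNge; apply/negP/negPn; apply: le_trans (N_le n) _.
  have /andP[p0 _] := p01 n.
  by rewrite -!mulrA mulr_le0_ge0 ?subr_le0 // !mulr_ge0 // invr_ge0.
apply: (@gnp_packs_cvg _ (1 / 2)) => //.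
- by apply/andP; split; lra.
- move=> n; case: (N n) (@N0 n) => [|k] nk; last by case: (nk ord0).
  have /andP[p0 _] := p01 n.
  have half : 0 <= 1 - 1 / 2 :> R by rewrite subr_ge0 ler_pdivrMr // mul1r ler1n.
  exact: divr_ge0 (mulr_ge0 (mulr_ge0 half (ler0n _ _)) p0) (ler0n _ _).
- by move=> n i; case: (N0 n i).
- by move=> n i; case: (N0 n i).
Qed.
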